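(* For each fixed $k\ge 0$, the class of Eulerian digraphs of carving width at most $k$ is well-quasi-ordered by strong immersion: for every infinite sequence $G_1,G_2,\dots$ of Eulerian digraphs each of carving width at most $k$ there are $i<j$ such that $G_i$ strongly immerses into $G_j$.
   Context: All digraphs are finite and may contain loops and parallel edges; a digraph is Eulerian if every vertex has in-degree equal to out-degree. For $X\subseteq V(G)$, $\rho(X)$ denotes the set of edges with one end in $X$ and the other end in $V(G)\setminus X$ (loops are never in $\rho(X)$). A carving of $G$ is a pair $(T,\ell)$ where $T$ is a tree in which every non-leaf vertex has degree three and $\ell$ is an injective map from $V(G)$ into the set of leaves of $T$. For an edge $t_1t_2$ of $T$, let $T_1$ be the component of $T-t_1t_2$ containing $t_1$ and $X$ the set of vertices of $G$ mapped by $\ell$ to leaves of $T_1$; the width of $t_1t_2$ is $|\rho(X)|$. The width of $(T,\ell)$ is the maximum width of an edge of $T$, and the carving width of $G$ is the minimum width of a carving of $G$. A path is a sequence of pairwise distinct edges $(e_1,\dots,e_m)$ with $\mathrm{head}(e_i)=\mathrm{tail}(e_{i+1})$, with internal vertices $\mathrm{head}(e_1),\dots,\mathrm{head}(e_{m-1})$. A strong immersion of $H$ into $G$ maps vertices of $H$ injectively to vertices of $G$ and each edge $(u,v)$ of $H$ to a path from the image of $u$ to the image of $v$, with pairwise edge-disjoint paths for distinct edges, and no image of a vertex of $H$ internal to any such path. *)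

(* Defs.v *)
From HB Require Import structures.
From mathcomp Require Import all_boot.

Set Implicit Arguments.
Unset Strict Implicit.
Unset Printing Implicit Defensive.

(* Edges form a type of their own, so loops and parallel edges are allowed. *)
Record digraph := Digraph {
  vertex : finType;
  edge : finType;
  tail : edge -> vertex;
  head : edge -> vertex
}.

Definition indegree (G : digraph) (v : vertex G) : nat :=
  #|[set e : edge G | head e == v]|.

Definition outdegree (G : digraph) (v : vertex G) : nat :=
  #|[set e : edge G | tail e == v]|.

Definition Eulerian (G : digraph) : Prop :=
  forall v : vertex G, indegree v = outdegree v.

Definition rho (G : digraph) (X : {set vertex G}) : {set edge G} :=
  [set e | (tail e \in X) != (head e \in X)].

Record tree := Tree {
  node : finType;
  adj : rel node;
  adj_sym : symmetric adj;
  adj_irr : irreflexive adj;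
  tree_nonempty : 0 < #|node|;
  tree_connected : forall s t : node, connect adj s t;
  tree_acyclic : forall c : seq node, 2 < size c -> ~~ ucycleb adj c
}.

Definition degree (T : tree) (t : node T) : nat := #|[set s | adj t s]|.

Definition leaf (T : tree) (t : node T) : bool := degree t == 1.

Definition adj_del (T : tree) (t1 t2 : node T) : rel (node T) :=
  [rel s t | adj s t && ((s, t) != (t1, t2)) && ((s, t) != (t2, t1))].

(* The component of T - t1t2 that contains t1. *)
Definition side (T : tree) (t1 t2 : node T) : {set node T} :=
  [set t | connect (adj_del t1 t2) t1 t].

(* carving_map need not be onto the leaves. *)
Record carving (G : digraph) := Carving {
  carving_tree : tree;
  carving_map : vertex G -> node carving_tree;
  carving_cubic : forall t : node carving_tree, ~~ leaf t -> degree t = 3;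
  carving_inj : injective carving_map;
  carving_leaf : forall v : vertex G, leaf (carving_map v)
}.

(* All values of carving_map are leaves of the tree, so the vertices mapped
   to leaves in the component are those mapped into the component. *)
Definition edge_width (G : digraph) (C : carving G)
    (t1 t2 : node (carving_tree C)) : nat :=
  #|rho [set v : vertex G | carving_map C v \in side t1 t2]|.

(* Each tree edge occurs as two ordered pairs. Their widths agree, since
   rho X = rho (~: X). *)
Definition width (G : digraph) (C : carving G) : nat :=
  \max_(p : node (carving_tree C) * node (carving_tree C) | adj p.1 p.2)
    edge_width p.1 p.2.

Definition is_carving_width (G : digraph) (w : nat) : Prop :=
  (exists C : carving G, width C = w) /\
  (forall C : carving G, w <= width C).

Definition carving_width_at_most (G : digraph) (k : nat) : Prop :=
  exists2 w : nat, is_carving_width G w & w <= k.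

(* A path has at least one edge, so a loop at u is carried to a nonempty
   closed path. Vertices may repeat; edges may not. *)
Definition dipath (G : digraph) (x y : vertex G) (p : seq (edge G)) : bool :=
  if p is e :: q then
    [&& uniq p, path [rel e1 e2 | head e1 == tail e2] e q,
        tail e == x & head (last e q) == y]
  else false.

(* belast e q is the path e :: q without its last edge. *)
Definition internal (G : digraph) (p : seq (edge G)) : seq (vertex G) :=
  if p is e :: q then [seq head f | f <- belast e q] else [::].

Definition strong_immersion (H G : digraph)
    (etaV : vertex H -> vertex G) (etaE : edge H -> seq (edge G)) : Prop :=
  [/\ injective etaV,
      forall e : edge H, dipath (etaV (tail e)) (etaV (head e)) (etaE e),
      forall e f : edge H, e != f ->
        forall g : edge G, g \in etaE e -> g \notin etaE f
    & forall (e : edge H) (v : vertex H), etaV v \notin internal (etaE e)].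

Definition strongly_immerses (H G : digraph) : Prop :=
  exists (etaV : vertex H -> vertex G) (etaE : edge H -> seq (edge G)),
    strong_immersion etaV etaE.

(* Main.v *)
From mathcomp Require Import all_boot zify.
From Stdlib Require Import Classical IndefiniteDescription.
Require Import Defs.

(* Root a carving at one of its edges: it becomes a binary tree whose leaves
   are the vertices. Splitting such a tree along a minimum cut that is uncrossed
   as far as possible decreases a lexicographic measure, so the tree can be
   taken linked: if a subtree A lies below a subtree B, both boundaries have
   size p and all boundaries between them have size at least p, then no set
   between A and B has a smaller boundary. In an Eulerian digraph a splitting-off
   version of Menger's theorem then links all the boundary edges of A to those
   of B, in both directions at once, so A strongly immerses into B.
   For boundary-labelled pieces, immersions are transitive and can be glued
   along the nodes of the trees. By downward induction on p, the pieces composed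
   from a well-quasi-ordered set of pieces using inner boundaries of size at
   least p are well-quasi-ordered. In the induction step the trees are cut at
   their topmost boundaries of size p; the pieces below these immerse into the
   whole, so they are well-quasi-ordered by minimality of a bad sequence. *)

Set Implicit Arguments.
Unset Strict Implicit.
Unset Printing Implicit Defensive.

(** * Restricting binary trees *)

(** Being Eulerian enters through one count: exactly half of the edges of any boundary leave the
    set. So linkedness for the undirected function [cut] yields the cut condition for outgoing
    edges, and splitting off, which keeps the digraph balanced, serves both directions. The trails
    found stay in the larger set minus the smaller one, which makes the immersion strong.

    A subtree need not immerse into a tree above it when a smaller boundary lies between, so a
    minimal bad sequence of trees alone, as for Kruskal's theorem, is not enough. This is why the
    induction carries a bound [p] and an arbitrary base [Q]: pieces of boundary exactly [p] have
    nothing smaller between them, and they join [Q] when [p] is raised.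

    Gluing has to know which boundary edges coincide. Boundaries have at most [k] edges, so a finite
    set of labels suffices, and the coincidences at a node form one of finitely many patterns. A
    linkage dictates the labels of the smaller piece, whereas well-quasi-ordering concerns all
    injective labellings; the discrepancy is one of finitely many maps of labels. *)

Ltac mem_cases :=
  repeat match goal with
  | |- context [in_mem ?x ?A] => case: (in_mem x A) => //=
  end; try (by [auto | intuition]).

Inductive btree (V : Type) := Leaf of V | Node of btree V & btree V.

Section BinaryTree.
Variable V : finType.
Implicit Types (t l r x y z c : btree V) (o : option (btree V)) (A X : {set V}).

Fixpoint lset t : {set V} :=
  match t with Leaf v => [set v] | Node l r => lset l :|: lset r end.

Fixpoint wf t : bool :=
  match t with
  | Leaf _ => true
  | Node l r => [&& wf l, wf r & [disjoint lset l & lset r]]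
  end.

Fixpoint nodes t : seq {set V} :=
  lset t :: match t with Leaf _ => [::] | Node l r => nodes l ++ nodes r end.

Definition join o1 o2 : option (btree V) :=
  match o1, o2 with
  | Some a, Some b => Some (Node a b)
  | Some a, None => Some a
  | None, _ => o2
  end.

(** Branches that lose all their leaves disappear, and the nodes left with one child are contracted
    by [join]; hence the [option]. *)
Fixpoint restr X t : option (btree V) :=
  match t with
  | Leaf v => if v \in X then Some t else None
  | Node l r => join (restr X l) (restr X r)
  end.

Definition olset o := if o is Some t then lset t else set0.
Definition owf o := if o is Some t then wf t else true.

Lemma lset_nonempty t : lset t != set0.
Proof.
elim: t => [v|l Hl r _] /=; first by apply/set0Pn; exists v; rewrite inE.
by rewrite setU_eq0 negb_and Hl.
Qed.

Lemma lset_in_nodes t : lset t \in nodes t.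
Proof. by case: t => *; rewrite inE eqxx. Qed.

Lemma nodes_sub t A : A \in nodes t -> A \subset lset t.
Proof.
elim: t => [v|l Hl r Hr] /=; first by rewrite inE => /eqP->.
rewrite inE mem_cat => /orP[/eqP-> //|/orP[/Hl|/Hr] H];
  by apply: subset_trans H _; rewrite ?subsetUl ?subsetUr.
Qed.

Lemma olset_join o1 o2 : olset (join o1 o2) = olset o1 :|: olset o2.
Proof. by case: o1 o2 => [a|] [b|] //=; rewrite ?setU0 ?set0U. Qed.

Lemma olset_restr X t : olset (restr X t) = lset t :&: X.
Proof.
elim: t => [v|l Hl r Hr] /=; last by rewrite olset_join Hl Hr setIUl.
case: ifP => vX /=; apply/setP => u; rewrite !inE;
  by case: eqP => // ->; rewrite vX.
Qed.

Lemma restr_id X t : lset t \subset X -> restr X t = Some t.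
Proof.
elim: t => [v|l Hl r Hr] /=; first by rewrite sub1set => ->.
by rewrite subUset => /andP[/Hl-> /Hr->].
Qed.

Lemma restr_none X t : [disjoint lset t & X] -> restr X t = None.
Proof.
elim: t => [v|l Hl r Hr] /=; first by rewrite disjoints1 => /negbTE->.
by rewrite -setI_eq0 setIUl setU_eq0 !setI_eq0 => /andP[/Hl-> /Hr->].
Qed.
Lemma owf_join o1 o2 :
  owf o1 -> owf o2 -> [disjoint olset o1 & olset o2] -> owf (join o1 o2).
Proof. by case: o1 o2 => [a|] [b|] //= -> -> ->. Qed.

Lemma owf_restr X t : wf t -> owf (restr X t).
Proof.
elim: t => [v|l Hl r Hr] /=; first by case: ifP.
case/and3P=> /Hl H1 /Hr H2 D; apply: owf_join => //.
rewrite !olset_restr; apply: disjointWl (subsetIl _ _) _.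
exact: disjointWr (subsetIl _ _) D.
Qed.

Definition crosses X A := [&& X :&: A != set0, X :\: A != set0 & A :\: X != set0].

Lemma wf_laminar t A B : wf t -> A \in nodes t -> B \in nodes t ->
  [\/ A \subset B, B \subset A | [disjoint A & B]].
Proof.
elim: t => [v|l Hl r Hr] /=.
  by move=> _; rewrite !inE => /eqP-> /eqP->; constructor 1.
case/and3P=> wl wr D; rewrite !inE !mem_cat.
have S C : (C \in nodes l) || (C \in nodes r) -> C \subset lset l :|: lset r.
  by case/orP=> /nodes_sub/subset_trans; apply; rewrite ?subsetUl ?subsetUr.
move=> /orP[/eqP->|HA] /orP[/eqP->|HB].
- by constructor 1.
- by constructor 2; exact: S.
- by constructor 1; exact: S.
case/orP: HA => HA; case/orP: HB => HB; [exact: Hl| | |exact: Hr].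
  constructor 3; apply: disjointWl (nodes_sub HA) _.
  exact: disjointWr (nodes_sub HB) D.
constructor 3; rewrite disjoint_sym; apply: disjointWl (nodes_sub HB) _.
exact: disjointWr (nodes_sub HA) D.
Qed.

Section Uncross.
Variables (X A B : {set V}).
Hypothesis XA : crosses X A.
Hypothesis lam : [\/ B \subset A, A \subset B | [disjoint B & A]].

(** Since [B] is nested with [A] or disjoint from it, none of [X :&: A], [X :|: A], [X :\: A]
    crosses a node that [X] did not cross. They do not cross [A] itself ([crosses_self]), so each of
    them crosses strictly fewer nodes than [X]. *)
Lemma uncross_I : crosses (X :&: A) B -> crosses X B.
Proof.
case/and3P: XA => /set0Pn[a Ha] /set0Pn[b Hb] /set0Pn[c Hc].
case/and3P=> /set0Pn[u Hu] /set0Pn[v Hv] /set0Pn[w Hw].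
move: Ha Hb Hc Hu Hv Hw; rewrite !inE => Ha Hb Hc Hu Hv Hw.
case: lam => [/subsetP S|/subsetP S|]; last rewrite disjoints_subset => /subsetP D.
- apply/and3P; split; apply/set0Pn; [exists u|exists v|exists w];
  rewrite !inE; move: Hu Hv Hw (S v) (S w); mem_cases.
- by move: Hv (S v); mem_cases.
- by move: Hu (D u); rewrite !inE; mem_cases.
Qed.

Lemma uncross_U : crosses (X :|: A) B -> crosses X B.
Proof.
case/and3P: XA => /set0Pn[a Ha] /set0Pn[b Hb] /set0Pn[c Hc].
case/and3P=> /set0Pn[u Hu] /set0Pn[v Hv] /set0Pn[w Hw].
move: Ha Hb Hc Hu Hv Hw; rewrite !inE => Ha Hb Hc Hu Hv Hw.
case: lam => [/subsetP S|/subsetP S|]; last rewrite disjoints_subset => /subsetP D.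
- by move: Hw (S w); mem_cases.
- apply/and3P; split; apply/set0Pn; [exists a|exists v|exists w];
  rewrite !inE; move: Ha Hv Hw (S a) (S v); mem_cases.
- apply/and3P; split; apply/set0Pn; [exists u|exists a|exists w];
  rewrite !inE; move: Ha Hu Hw (D u) (D a); rewrite !inE; mem_cases.
Qed.

Lemma uncross_D : crosses (X :\: A) B -> crosses X B.
Proof.
case/and3P: XA => /set0Pn[a Ha] /set0Pn[b Hb] /set0Pn[c Hc].
case/and3P=> /set0Pn[u Hu] /set0Pn[v Hv] /set0Pn[w Hw].
move: Ha Hb Hc Hu Hv Hw; rewrite !inE => Ha Hb Hc Hu Hv Hw.
case: lam => [/subsetP S|/subsetP S|]; last rewrite disjoints_subset => /subsetP D.
- by move: Hu (S u); mem_cases.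
- apply/and3P; split; apply/set0Pn; [exists u|exists v|exists c];
  rewrite !inE; move: Hu Hv Hc (S c); mem_cases.
- apply/and3P; split; apply/set0Pn; [exists u|exists v|exists w];
  rewrite !inE; move: Hu Hv Hw (D w); rewrite !inE; mem_cases.
Qed.
End Uncross.

Lemma crosses_self (X A : {set V}) :
  [/\ crosses (X :&: A) A = false, crosses (X :|: A) A = false
     & crosses (X :\: A) A = false].
Proof.
split; apply/negP => /and3P[/set0Pn[u Hu] /set0Pn[v Hv] /set0Pn[w Hw]];
  move: Hu Hv Hw; rewrite !inE; mem_cases.
Qed.

End BinaryTree.

(** * Linked trees for a symmetric submodular function *)

Section LinkedTree.
Variable V : finType.
Variable f : {set V} -> nat.
Hypothesis f_submod : forall A B, f (A :&: B) + f (A :|: B) <= f A + f B.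
(** For symmetric [f] this is submodularity for [A] and the complement of [B]. *)
Hypothesis f_posimod : forall A B, f (A :\: B) + f (B :\: A) <= f A + f B.
Implicit Types (t l r x y z c : btree V) (o : option (btree V)) (A X : {set V}).

Definition heavy s A : nat := s <= f A.

Definition heavy_nodes s t := count (fun A => s <= f A) (nodes t).
(** Node counts do not detect a split in which all crossed nodes are as light as the cut. What
    disappears then is an edge on the path to [y], so edges with both ends heavy are counted as
    well. *)
Fixpoint heavy_edges s t : nat :=
  match t with
  | Leaf _ => 0
  | Node l r => heavy_edges s l + heavy_edges s r + heavy s (lset t) * (heavy s (lset l) + heavy s (lset r))
  end.
Definition oheavy_nodes s o := if o is Some t then heavy_nodes s t else 0.
Definition oheavy_edges s o := if o is Some t then heavy_edges s t else 0.
Definition crossed_at s X t := count (fun A => crosses X A && (f A == s)) (nodes t).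

Lemma heavy_nodes_Node s l r : heavy_nodes s (Node l r) = heavy_nodes s l + heavy_nodes s r + heavy s (lset (Node l r)).
Proof. by rewrite /heavy_nodes /= count_cat addnC. Qed.

Lemma crossed_at_Node s X l r : crossed_at s X (Node l r) =
  crossed_at s X l + crossed_at s X r + (crosses X (lset (Node l r)) && (f (lset (Node l r)) == s)).
Proof. by rewrite /crossed_at /= count_cat addnC. Qed.

Lemma oheavy_nodes_join s o1 o2 : oheavy_nodes s (join o1 o2) =
  oheavy_nodes s o1 + oheavy_nodes s o2 + ((olset o1 != set0) && (olset o2 != set0)) * heavy s (olset o1 :|: olset o2).
Proof.
case: o1 o2 => [a|] [b|] /=; rewrite ?eqxx ?andbF ?mul0n ?addn0 //.
by rewrite heavy_nodes_Node !lset_nonempty mul1n.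
Qed.

Lemma oheavy_edges_join s o1 o2 : oheavy_edges s (join o1 o2) =
  oheavy_edges s o1 + oheavy_edges s o2 + ((olset o1 != set0) && (olset o2 != set0)) *
    (heavy s (olset o1 :|: olset o2) * (heavy s (olset o1) + heavy s (olset o2))).
Proof.
case: o1 o2 => [a|] [b|] /=; rewrite ?eqxx ?andbF ?mul0n ?addn0 //.
by rewrite !lset_nonempty mul1n.
Qed.

Lemma join_cases X c : ~~ crosses X (lset c) -> ~~ (X \subset lset c) ->
  restr X c = Some c /\ restr (~: X) c = None \/
  restr X c = None /\ restr (~: X) c = Some c.
Proof.
move=> nc nX; have XA : X :\: lset c != set0 by rewrite setD_eq0.
move: nc; rewrite /crosses XA /= negb_and !negbK => /orP[/eqP XI|].
  right; rewrite restr_none ?restr_id // -?disjoints_subset -setI_eq0 setIC XI //.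
rewrite setD_eq0 => cX; left; rewrite restr_id // restr_none //.
by rewrite disjoints_subset setCK.
Qed.

Definition drops X c := {in nodes c, forall A, crosses X A ->
  f (A :&: X) < f A /\ f (A :\: X) < f A}.

Lemma crosses_sub X A (B : {set V}) :
  A \subset B -> ~~ (X \subset B) -> crosses X A -> crosses X B.
Proof.
move=> AB nX /and3P[XA _ AX]; rewrite /crosses setD_eq0 nX /=; apply/andP; split.
  by apply: contraNneq XA => E; rewrite -subset0 -E setIS.
by apply: contraNneq AX => E; rewrite -subset0 -E setSD.
Qed.

Lemma nodes_NodeP (P : {set V} -> Prop) l r : {in nodes (Node l r), forall A, P A} ->
  [/\ P (lset (Node l r)), {in nodes l, forall A, P A} & {in nodes r, forall A, P A}].
Proof.
move=> H; split; first by apply: H; exact: lset_in_nodes.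
  by move=> A HA; apply: H; rewrite /= inE mem_cat HA orbT.
by move=> A HA; apply: H; rewrite /= inE mem_cat HA !orbT.
Qed.

Lemma heavy0 s A : f A < s -> heavy s A = 0.
Proof. by rewrite /heavy ltnNge => /negbTE->. Qed.

(** A crossed node [A] is replaced by two strictly lighter traces. If no crossed weight exceeds [s],
    neither trace is heavy, so every crossed node of weight exactly [s] is a net loss. A subtree
    whose top is not crossed goes unchanged to one side. *)
Lemma off_path s X c : drops X c -> ~~ (X \subset lset c) ->
  ({in nodes c, forall A, crosses X A -> f A <= s} ->
     oheavy_nodes s (restr X c) + oheavy_nodes s (restr (~: X) c) + crossed_at s X c <= heavy_nodes s c) /\
  ({in nodes c, forall A, crosses X A -> f A < s} ->
     oheavy_edges s (restr X c) + oheavy_edges s (restr (~: X) c) <= heavy_edges s c).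
Proof.
have main c' : ~~ (X \subset lset c') -> ~~ crosses X (lset c') ->
   oheavy_nodes s (restr X c') + oheavy_nodes s (restr (~: X) c') + crossed_at s X c' <= heavy_nodes s c' /\
   oheavy_edges s (restr X c') + oheavy_edges s (restr (~: X) c') <= heavy_edges s c'.
  move=> nX nc; have -> : crossed_at s X c' = 0.
    apply/eqP; rewrite -leqn0 leqNgt -has_count; apply: contraNN nc.
    by case/hasP=> A /nodes_sub HA /andP[/(crosses_sub HA nX)].
  by case: (join_cases nc nX) => -[-> ->] /=; rewrite ?addn0 ?add0n.
elim: c => [v|l Hl r Hr] dr nX.
  have nc : ~~ crosses X [set v].
    apply/negP=> /and3P[/set0Pn[a]]; rewrite !inE => /andP[aX /eqP va] _.
    by rewrite -va setD_eq0 sub1set aX.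
  by have [] := main (Leaf v) nX nc.
have [cr|nc] := boolP (crosses X (lset (Node l r))); last by have [] := main _ nX nc.
have nl : ~~ (X \subset lset l).
  by apply: contraNN nX => S; apply: subset_trans S (subsetUl _ _).
have nr : ~~ (X \subset lset r).
  by apply: contraNN nX => S; apply: subset_trans S (subsetUr _ _).
have [/(_ cr)[d1 d2] dl dr'] := nodes_NodeP dr.
have [Hl1 Hl2] := Hl dl nl; have [Hr1 Hr2] := Hr dr' nr.
have E Y : restr Y (Node l r) = join (restr Y l) (restr Y r) by [].
have E1 : lset l :&: X :|: lset r :&: X = lset (Node l r) :&: X by rewrite -setIUl.
have E2 : lset l :&: ~: X :|: lset r :&: ~: X = lset (Node l r) :\: X.
  by rewrite -setIUl setDE.
split=> /nodes_NodeP[/(_ cr) fs fl fr].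
  move: (Hl1 fl) (Hr1 fr).
  rewrite !E !oheavy_nodes_join !olset_restr E1 E2 crossed_at_Node heavy_nodes_Node cr.
  rewrite (heavy0 (leq_trans d1 fs)) (heavy0 (leq_trans d2 fs)) !muln0 /heavy.
  have : (f (lset (Node l r)) == s) <= (s <= f (lset (Node l r))).
    by case: eqP => // ->; rewrite leqnn.
  by rewrite andTb; lia.
move: (Hl2 fl) (Hr2 fr).
rewrite !E !oheavy_edges_join !olset_restr E1 E2.
rewrite (heavy0 (ltn_trans d1 fs)) (heavy0 (ltn_trans d2 fs)) !mul0n !muln0.
by rewrite [heavy_edges s (Node l r)]/=; lia.
Qed.

(** The bound is imposed on the whole path, both ends included; [below 0] is the plain subtree
    relation. *)
Inductive below p y : btree V -> Prop :=
| Below_refl : p <= f (lset y) -> below p y y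
| Below_node z x c : p <= f (lset z) -> z = Node x c \/ z = Node c x ->
    below p y x -> below p y z.

(** These are the traces a crossed node leaves in the new tree: [A :&: X] and [A :|: X] if it is on
    the path above [y], [A :&: X] and [A :\: X] if it is off the path. Nodes below [y] lie inside
    [X] and are not crossed. *)
Definition trades X y z := {in nodes z, forall A, crosses X A ->
  (lset y \subset A -> f (A :&: X) < f A /\ f (A :|: X) < f A) /\
  ([disjoint A & lset y] -> f (A :&: X) < f A /\ f (A :\: X) < f A)}.

Lemma below_sub p x y : below p y x -> {subset nodes y <= nodes x}.
Proof.
elim=> [_ A //|z {}x c _ E _ IH A /IH].
by case: E => ->; rewrite /= inE mem_cat => ->; rewrite ?orbT.
Qed.

Lemma below_top p x y : below p y x -> p <= f (lset x).
Proof. by case. Qed.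

Lemma below_wf p x y : below p y x -> wf x -> wf y.
Proof. by elim=> // z {}x c _ Ez _ IH wz; apply: IH; case: Ez wz => -> /= /and3P[]. Qed.

Lemma heavy1 s A : s <= f A -> heavy s A = 1.
Proof. by rewrite /heavy => ->. Qed.

(** Bookkeeping for [path_copy]: the bounds for the child on the path, the child off the path and
    the top node add up. *)
Fact add_steps_M (a1 a2 a3 b1 b2 b3 c1 c2 c3 m1 m2 m3 n : nat) :
  a3 + b3 + c3 <= m3 -> a1 + b1 + c1 <= m1 + n -> a2 + b2 + c2 <= m2 ->
  a1 + a2 + a3 + (b1 + b2 + b3) + (c1 + c2 + c3) <= m1 + m2 + m3 + n.
Proof. lia. Qed.

Fact add_steps_K (a1 a2 a3 b1 b2 b3 c1 c3 m1 m2 m3 n : nat) :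
  a3 + b3 + c3 <= m3 + c1 -> a1 + b1 + c1 <= m1 + n -> a2 + b2 <= m2 ->
  a1 + a2 + a3 + (b1 + b2 + b3) + c3 <= m1 + m2 + m3 + n.
Proof. lia. Qed.

Section Path.
Variables (X : {set V}) (y T : btree V) (p : nat).
Hypotheses (yX : lset y \subset X) (Xy : ~~ (X \subset lset y)).
Hypotheses (TX : lset T = X) (wT : wf T).

(* [O] is [z] without its leaves in [X] and with [y] replaced by [T]; for
   [T = restr X x] and [z = x] this is the new tree. *)
Lemma path_copy z : below p y z -> wf z -> trades X y z ->
  exists O, [/\ wf O, lset O = lset z :|: X & forall s, f X < s ->
    ({in nodes z, forall A, crosses X A -> f A <= s} ->
       oheavy_nodes s (restr X z) + heavy_nodes s O + crossed_at s X z <= heavy_nodes s z + heavy_nodes s T) /\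
    ({in nodes z, forall A, crosses X A -> f A < s} ->
       oheavy_edges s (restr X z) + heavy_edges s O + ((s <= p) && (X \subset lset z))
       <= heavy_edges s z + heavy_edges s T)].
Proof.
have y0 := lset_nonempty y.
elim=> {z} [_ wy _|z z1 c pz Ez bl IH wz tr].
  exists T; split => //; first by rewrite TX; apply/esym/setUidPr.
  move=> s fs; rewrite restr_id //= (negbTE Xy) andbF addn0; split=> //.
  have -> : crossed_at s X y = 0; last by rewrite addn0.
  apply/eqP; rewrite -leqn0 leqNgt -has_count -all_predC; apply/allP=> A /nodes_sub Ay /=.
  have AX := subset_trans Ay yX.
  by rewrite /crosses (eqP (_ : A :\: X == set0)) ?setD_eq0 // eqxx !andbF.
have yz1 : lset y \subset lset z1 by apply: nodes_sub; apply: (below_sub bl); exact: lset_in_nodes.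
have [wz1 wc D] : [/\ wf z1, wf c & [disjoint lset z1 & lset c]].
  by move: wz; case: Ez => -> /= /and3P[-> ->]; rewrite // disjoint_sym.
have Lz : lset z = lset z1 :|: lset c by case: Ez => -> //=; rewrite setUC.
have nz (P : {set V} -> Prop) : {in nodes z, forall A, P A} ->
    [/\ P (lset z), {in nodes z1, forall A, P A} & {in nodes c, forall A, P A}].
  by case: Ez => -> /nodes_NodeP[].
have [tz tz1 tc] := nz _ tr.
have yc : [disjoint lset y & lset c] by exact: disjointWl yz1 D.
have Xc : ~~ (X \subset lset c).
  apply: contraNN y0 => Xc; rewrite -subset0 -(eqP (_ : lset y :&: lset c == set0)) ?setI_eq0 //.
  by rewrite subsetI subxx (subset_trans yX).
have dc : drops X c.
  move=> A HA cA; apply: (tc A HA cA).2; rewrite disjoint_sym.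
  by apply: disjointWr (nodes_sub HA) yc.
have [O1 [wO1 LO1 HO1]] := IH wz1 tz1.
have : exists2 O, join (Some O1) (restr (~: X) c) = Some O & wf O.
  case Ec: (restr (~: X) c) => [c'|]; last by exists O1.
  exists (Node O1 c') => //=; rewrite wO1 /=; have := owf_restr (~: X) wc.
  have := olset_restr (~: X) c; rewrite Ec /= => -> -> /=.
  rewrite LO1 -setI_eq0 -setDE -subset0; apply/subsetP => v.
  move: D; rewrite disjoints_subset => /subsetP/(_ v).
  by rewrite !inE; mem_cases.
case=> O EO wO; exists O.
have LO : lset O = lset z :|: X.
  have := olset_join (Some O1) (restr (~: X) c); rewrite EO /= olset_restr LO1 Lz => ->.
  by apply/setP=> v; rewrite !inE; mem_cases.
split=> // s fs; have [h1 h2] := HO1 s fs; have [g1 g2] := off_path s dc Xc.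
have EM : oheavy_nodes s (restr X z) = oheavy_nodes s (restr X z1) + oheavy_nodes s (restr X c) +
    (lset c :&: X != set0) * heavy s (lset z :&: X).
  have n1 : lset z1 :&: X != set0.
    by apply: contraNneq y0 => E; rewrite -subset0 -E subsetI yz1.
  case: Ez => ->; rewrite oheavy_nodes_join !olset_restr n1 -setIUl ?andbT //.
  by rewrite [oheavy_nodes s _ + oheavy_nodes s _]addnC.
have EM' : heavy_nodes s O = heavy_nodes s O1 + oheavy_nodes s (restr (~: X) c) +
    (lset c :\: X != set0) * heavy s (lset z :|: X).
  have := oheavy_nodes_join s (Some O1) (restr (~: X) c); rewrite EO /= => ->.
  rewrite lset_nonempty olset_restr -setDE LO1; congr (_ + _ * heavy _ _).
  by rewrite Lz; apply/setP=> v; rewrite !inE; mem_cases.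
have EK : oheavy_edges s (restr X z) = oheavy_edges s (restr X z1) + oheavy_edges s (restr X c) +
    (lset c :&: X != set0) *
      (heavy s (lset z :&: X) * (heavy s (lset z1 :&: X) + heavy s (lset c :&: X))).
  have n1 : lset z1 :&: X != set0.
    by apply: contraNneq y0 => E; rewrite -subset0 -E subsetI yz1.
  case: Ez => ->; rewrite oheavy_edges_join !olset_restr n1 -setIUl ?andbT //.
  by rewrite [oheavy_edges s _ + oheavy_edges s _]addnC [heavy s (lset c :&: X) + _]addnC.
have EK' : heavy_edges s O = heavy_edges s O1 + oheavy_edges s (restr (~: X) c) +
    (lset c :\: X != set0) *
      (heavy s (lset z :|: X) * (heavy s (lset z1 :|: X) + heavy s (lset c :\: X))).
  have := oheavy_edges_join s (Some O1) (restr (~: X) c); rewrite EO /= => ->.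
  rewrite lset_nonempty olset_restr -setDE LO1; congr (_ + _ * (heavy _ _ * _)).
  by rewrite Lz; apply/setP=> v; rewrite !inE; mem_cases.
have MZ : heavy_nodes s z = heavy_nodes s z1 + heavy_nodes s c + heavy s (lset z).
  by case: Ez => ->; rewrite heavy_nodes_Node // [heavy_nodes s c + _]addnC.
have CZ : crossed_at s X z = crossed_at s X z1 + crossed_at s X c + (crosses X (lset z) && (f (lset z) == s)).
  by case: Ez => ->; rewrite crossed_at_Node // [crossed_at s X c + _]addnC.
have KZ : heavy_edges s z = heavy_edges s z1 + heavy_edges s c + heavy s (lset z) * (heavy s (lset z1) + heavy s (lset c)).
  by case: Ez => -> //=; rewrite [heavy_edges s c + _]addnC [heavy s (lset c) + _]addnC.
rewrite EM EM' EK EK' MZ CZ KZ {EM EM' EK EK' MZ CZ KZ}.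
have yz : lset y \subset lset z by rewrite Lz; apply: subset_trans yz1 (subsetUl _ _).
have nc A : lset y \subset A -> ~~ crosses X A -> (A \subset X) || (X \subset A).
  move=> yA; rewrite /crosses !setD_eq0.
  have -> /= : X :&: A != set0.
    by apply: contraNneq y0 => E; rewrite -subset0 -E subsetI yX.
  by rewrite negb_and !negbK orbC.
split=> /nz[fz fz1 fc].
  move: (h1 fz1) (g1 fc) => {h1 h2 g1 g2} h1 g1.
  suff : (lset c :&: X != set0) * heavy s (lset z :&: X) +
    (lset c :\: X != set0) * heavy s (lset z :|: X) +
    (crosses X (lset z) && (f (lset z) == s)) <= heavy s (lset z).
    by move/add_steps_M; apply.
  (* If [z] crosses [X], both traces weigh less than [s]. If it lies in [X], only its copy in the
     restriction survives. If it contains [X], its trace there is [X], again lighter than [s], and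
     only the copy in [O] counts. *)
  have [cz|/(nc _ yz)/orP[zX|Xz]] := boolP (crosses X (lset z)).
  - have [d1 d2] := (tz cz).1 yz.
    rewrite (heavy0 (leq_trans d1 (fz cz))) (heavy0 (leq_trans d2 (fz cz))) !muln0 /heavy.
    by case: eqP => [->|]; rewrite ?leqnn.
  - have -> : lset c :\: X = set0.
      by apply/eqP; rewrite setD_eq0; apply: subset_trans zX; rewrite Lz subsetUr.
    by rewrite eqxx (setIidPl zX) /= !addn0; case: (_ != set0); rewrite ?mul1n.
  - by rewrite (setIidPr Xz) (heavy0 fs) (setUidPl Xz) muln0 !addn0; case: (_ != set0);
      rewrite ?mul1n.
move: (h2 fz1) (g2 fc) => {h1 h2 g1 g2} h2 g2.
suff : (lset c :&: X != set0) *
      (heavy s (lset z :&: X) * (heavy s (lset z1 :&: X) + heavy s (lset c :&: X))) +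
    (lset c :\: X != set0) *
      (heavy s (lset z :|: X) * (heavy s (lset z1 :|: X) + heavy s (lset c :\: X))) +
    ((s <= p) && (X \subset lset z)) <=
  heavy s (lset z) * (heavy s (lset z1) + heavy s (lset c)) +
    ((s <= p) && (X \subset lset z1)).
  by move/add_steps_K; apply.
have [cz|/(nc _ yz)/orP[zX|Xz]] := boolP (crosses X (lset z)).
- have [d1 d2] := (tz cz).1 yz.
  rewrite (heavy0 (ltn_trans d1 (fz cz))) (heavy0 (ltn_trans d2 (fz cz))) !mul0n !muln0.
  case/and3P: cz => _ XZ _; rewrite setD_eq0 in XZ.
  by rewrite (negbTE XZ) andbF.
- have cX : lset c \subset X by apply: subset_trans zX; rewrite Lz subsetUr.
  have z1X : lset z1 \subset X by apply: subset_trans zX; rewrite Lz subsetUl.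
  have -> : lset c :\: X = set0 by apply/eqP; rewrite setD_eq0.
  rewrite eqxx !(setIidPl _) // mul0n addn0.
  have -> : (s <= p) && (X \subset lset z) = false.
    apply/negP=> /andP[sp Xz]; have E : lset z = X by apply/eqP; rewrite eqEsubset zX.
    by move: pz; rewrite E leqNgt (leq_trans fs sp).
  by rewrite addn0; case: (_ != set0); rewrite ?mul1n ?mul0n // leq_addr.
- rewrite (setIidPr Xz) (heavy0 fs) mul0n muln0 add0n (setUidPl Xz) Xz andbT.
  have [Xz1|Xz1] := boolP (X \subset lset z1).
    rewrite (setUidPl Xz1) andbT leq_add2r.
    have -> : lset c :\: X = lset c.
      apply/setDidPl; rewrite disjoint_sym; exact: disjointWl Xz1 D.
    by case: (_ != set0); rewrite ?mul1n.
  (* Here [z] is the first node on the path that contains [X]. Both [z] and [z1] weigh at least [p],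
     so for [s <= p] the edge between them is heavy; in [O] its lower end is [lset z1 :|: X], which
     is lighter than [s]. This is the edge that gets lost. *)
  have pz1 := below_top bl.
  have -> : heavy s (lset z1 :|: X) = 0.
    have [cz1|/(nc _ yz1)/orP[z1X|]] := boolP (crosses X (lset z1)); last 2 first.
    - by rewrite (setUidPr z1X) heavy0.
    - by rewrite (negbTE Xz1).
    have Hz1 := lset_in_nodes z1.
    by rewrite heavy0 //; apply: ltn_trans (fz1 _ Hz1 cz1); have [] := (tz1 _ Hz1 cz1).1 yz1.
  have -> : (lset c :\: X != set0) * (heavy s (lset z) * (0 + heavy s (lset c :\: X))) = 0.
    have [//|cX] := eqVneq (lset c :\: X) set0.
    have cc : crosses X (lset c).
      rewrite /crosses cX setD_eq0 Xc !andbT.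
      apply: contraNneq Xz1 => E; apply/subsetP => v vX.
      have := subsetP Xz v vX; rewrite Lz inE => /orP[//|vc].
      by have := in_set0 v; rewrite -E inE vX vc.
    have Hc := lset_in_nodes c; have [_ dX] := dc _ Hc cc.
    by rewrite (heavy0 (ltn_trans dX (fc _ Hc cc))) addn0 !muln0.
  rewrite add0n andbF addn0; have [sp|//] := boolP (s <= p).
  by rewrite (heavy1 (leq_trans sp pz)) (heavy1 (leq_trans sp pz1)) mul1n.
Qed.
End Path.

Lemma count_lt (I : eqType) (a b : pred I) (u : seq I) i :
  {in u, forall j, a j -> b j} -> i \in u -> b i -> ~~ a i -> count a u < count b u.
Proof.
elim: u => // j u IH sub; rewrite inE => iu bi nai /=.
have subu : {in u, forall k, a k -> b k}.
  by move=> k ku; apply: sub; rewrite inE ku orbT.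
have ab : a j <= b j by move: (sub j (mem_head _ _)); case: (a j) => // ->.
case/orP: iu => [/eqP <-|iu]; last by rewrite -addnS leq_add // IH.
rewrite (negbTE nai) bi ltnS; apply: leq_trans (_ : count b [seq k <- u | a k] <= _).
  by rewrite count_filter; apply/eq_leq/eq_in_count => k /subu /=; case: (a k) => [->|]; rewrite ?andbF ?andbT.
by rewrite count_filter; apply: sub_count => k /andP[].
Qed.

Fact lex_le (a b c d n : nat) : d < n -> a * n + b <= c * n + d -> a <= c.
Proof.
move=> dn le; rewrite -ltnS -(ltn_pmul2r (leq_ltn_trans (leq0n _) dn)) mulSn.
by apply: leq_ltn_trans (leq_addr b _) _; lia.
Qed.

Fact lex_lt (a b c d n : nat) : a * n + b <= c * n + d -> d < b -> a < c.
Proof.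
move=> le db; rewrite ltnNge; apply: contraTN le => ca; rewrite -ltnNge.
by rewrite -addnS leq_add // leq_mul2r ca orbT.
Qed.

Fact sum_ltl (a b c d : nat) : a + b <= c + d -> d < b -> a < c.
Proof. lia. Qed.

Fact sum_ltr (a b c d : nat) : a + b <= c + d -> d < a -> b < c.
Proof. lia. Qed.

(* Uncrossing [X] with [A] would keep [f X] minimal and lower the number of
   crossed nodes, so each uncrossed set is strictly worse than [X]. *)
Lemma min_cut_trades x y X0 : wf x -> lset y \subset X0 -> X0 \subset lset x ->
  exists X, [/\ lset y \subset X, X \subset lset x, f X <= f X0 & trades X y x].
Proof.
move=> wx yX0 X0x.
pose P X := (lset y \subset X) && (X \subset lset x).
pose ncr X := count (crosses X) (nodes x).
(* The factor exceeds every value of [ncr], so [w] compares [f] first and the number of crossed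
   nodes second. *)
pose w X := f X * (size (nodes x)).+1 + ncr X.
have [X /andP[yX Xx] Xmin] := @arg_minnP _ X0 P w (introT andP (conj yX0 X0x)).
have szc Z : ncr Z < (size (nodes x)).+1 by rewrite ltnS count_size.
have fmin Z : P Z -> f X <= f Z.
  by move=> /Xmin; apply: (lex_le (szc Z)).
have fmin' Z : P Z -> ncr Z < ncr X -> f X < f Z.
  by move=> /Xmin; apply: lex_lt.
exists X; split=> //; first by apply: fmin; rewrite /P yX0.
move=> A HA cA; have Ax := nodes_sub HA; have [sI sU sD] := crosses_self X A.
have lam B : B \in nodes x -> [\/ B \subset A, A \subset B | [disjoint B & A]].
  by move=> HB; apply: wf_laminar HB HA.
have nI : ncr (X :&: A) < ncr X.
  by apply: (count_lt (i := A)) => // [B /lam l|]; [exact: uncross_I|rewrite sI].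
have nU : ncr (X :|: A) < ncr X.
  by apply: (count_lt (i := A)) => // [B /lam l|]; [exact: uncross_U|rewrite sU].
have nD : ncr (X :\: A) < ncr X.
  by apply: (count_lt (i := A)) => // [B /lam l|]; [exact: uncross_D|rewrite sD].
have PU : P (X :|: A).
  by rewrite /P subUset Xx Ax (subset_trans yX (subsetUl _ _)).
have gU := fmin' _ PU nU; have sub := f_submod A X.
rewrite setIC setUC in sub; split=> [yA|D].
  have PI : P (X :&: A) by rewrite /P subsetI yX yA (subset_trans (subsetIl _ _) Xx).
  have gI := fmin' _ PI nI.
  by rewrite setIC setUC; split; [exact: sum_ltl sub gU|exact: sum_ltr sub gI].
have PD : P (X :\: A).
  by rewrite /P subsetD yX (subset_trans (subsetDl _ _) Xx) disjoint_sym D.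
have gD := fmin' _ PD nD; have pos := f_posimod A X.
by rewrite setIC; split; [exact: sum_ltl sub gU|exact: sum_ltl pos gD].
Qed.

(* The measure that splitting decreases: ranks compared lexicographically,
   starting from the largest [i]. *)
Definition rank i t := if odd i then heavy_nodes i./2 t else heavy_edges i./2 t.

(** The new tree is [x] without its leaves in [X], with the restriction of [x] to [X] hung in the
    place of [y]. Which rank drops depends on whether some crossed node is heavier than [X]. *)
Lemma improve x y p X0 : wf x -> below p y x -> p <= f (lset y) ->
  lset y \subset X0 -> X0 \subset lset x -> f X0 < p ->
  exists x', [/\ wf x', lset x' = lset x &
    exists2 j, rank j x' < rank j x & forall i, j < i -> rank i x' <= rank i x].
Proof.
move=> wx bl py yX0 X0x fX0; have px := below_top bl.
have [X [yX Xx fX tr]] := min_cut_trades wx yX0 X0x.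
have fXp := leq_ltn_trans fX fX0.
have Xy : ~~ (X \subset lset y).
  apply: contraTN fXp => Xy; rewrite -leqNgt.
  by have -> : X = lset y by apply/eqP; rewrite eqEsubset Xy.
have : exists2 T, restr X x = Some T & wf T.
  have := olset_restr X x; have := owf_restr X wx.
  case: (restr X x) => [T wT _|/= _ E]; first by exists T.
  have := lset_nonempty y; rewrite -subset0 {}E => /negP[].
  by rewrite subsetI yX (subset_trans yX).
case=> T ET wT; have TX : lset T = X.
  by have := olset_restr X x; rewrite ET /= => ->; apply/setIidPr.
have [O [wO LO HO]] := path_copy yX Xy TX wT bl wx tr.
exists O; split=> //; first by rewrite LO; apply/setUidPl.
rewrite ET /= in HO.
have HM s : f X < s -> {in nodes x, forall A, crosses X A -> f A <= s} ->
    heavy_nodes s O + crossed_at s X x <= heavy_nodes s x by move=> fs; case: (HO s fs) => h _ /h; rewrite -addnA [heavy_nodes s T + _]addnC leq_add2r.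
have HK s : f X < s -> {in nodes x, forall A, crosses X A -> f A < s} ->
    heavy_edges s O + (s <= p) <= heavy_edges s x.
  by move=> fs; case: (HO s fs) => _ h /h; rewrite Xx andbT -addnA [heavy_edges s T + _]addnC leq_add2r.
have [|no] := boolP (has (fun A => crosses X A && (f X < f A)) (nodes x)).
  pose P m := has (fun A => crosses X A && (f A == m)) (nodes x) && (f X < m).
  case/hasP => A0 HA0 /andP[c0 lt0].
  have exP : exists m, P m.
    by exists (f A0); rewrite /P lt0 andbT; apply/hasP; exists A0; rewrite ?c0 /=.
  have ubP m : P m -> m <= \max_(A : {set V}) f A.
    by case/andP => /hasP[A _ /andP[_ /eqP <-]] _; apply: leq_bigmax.
  case: (ex_maxnP exP ubP) => m /andP[hm fm] mmax.
  have mx : {in nodes x, forall A, crosses X A -> f A <= m}.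
    move=> A HA cA; have [|/leq_trans] := ltnP (f X) (f A); last by apply; exact: ltnW.
    move=> lt; apply: mmax; rewrite /P lt andbT.
    by apply/hasP; exists A; rewrite ?cA /=.
  (* The odd index is the node count at level [m], the largest crossed weight. It drops by the
     number of crossed nodes of weight [m], and no rank above it grows. *)
  exists m.*2.+1 => [|i mi].
    rewrite /rank /= odd_double /= uphalf_double.
    apply: leq_trans (HM m fm mx); rewrite -addn1 leq_add2l.
    by rewrite -has_count.
  have {}mi : m < i./2 by rewrite geq_half_double doubleS.
  have fi := ltn_trans fm mi.
  rewrite /rank; case: ifP => _.
    apply: leq_trans (leq_addr _ _) (HM _ fi _) => A HA /(mx A HA) h.
    exact: leq_trans h (ltnW mi).
  apply: leq_trans (leq_addr _ _) (HK _ fi _) => A HA /(mx A HA) h.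
  exact: leq_ltn_trans h mi.
have mx : {in nodes x, forall A, crosses X A -> f A <= f X}.
  move=> A HA cA; rewrite leqNgt; apply: contraNN no => lt.
  by apply/hasP; exists A; rewrite ?cA.
(* All crossed nodes weigh at most [f X]. The even index is the edge count at level [(f X).+1],
   which is at most [p], so the edge lost on the path makes it drop. *)
exists (f X).+1.*2 => [|i mi].
  rewrite /rank odd_double doubleK; apply: leq_trans (HK (f X).+1 (leqnn _) _).
    by rewrite fXp addn1.
  by move=> A HA /(mx A HA).
have fi : f X < i./2 by rewrite geq_half_double ltnW.
rewrite /rank; case: ifP => oi.
  apply: leq_trans (leq_addr _ _) (HM _ fi _) => A HA /(mx A HA) h.
  exact: leq_trans h (ltnW fi).
apply: leq_trans (leq_addr _ _) (HK _ fi _) => A HA /(mx A HA) h.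
exact: leq_ltn_trans h fi.
Qed.

Definition linked t := forall x y X, below 0 x t -> below (f (lset x)) y x ->
  f (lset y) = f (lset x) -> lset y \subset X -> X \subset lset x ->
  f (lset x) <= f X.

Lemma heavy_nodes_gt0 s t : (0 < heavy_nodes s t) = has (fun A => s <= f A) (nodes t).
Proof. by rewrite has_count. Qed.

Lemma rank0 i k t : {in nodes t, forall A, f A <= k} -> k < i./2 -> rank i t = 0.
Proof.
move=> H ki; rewrite /rank; case: ifP => _.
  apply/eqP; rewrite -leqn0 leqNgt heavy_nodes_gt0; apply/hasP => -[A /H Ak].
  by rewrite leqNgt (leq_ltn_trans Ak ki).
elim: t H => //= l Hl r Hr /nodes_NodeP[Ht /Hl-> /Hr->].
by rewrite heavy0 //; apply: leq_ltn_trans Ht ki.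
Qed.

(** A binary tree with [n] leaves has [2n - 1] nodes and [2n - 2] edges. *)
Lemma rank_le i t : wf t -> rank i t <= #|lset t|.*2.
Proof.
move=> wt; rewrite /rank; have hi_le s A : heavy s A <= 1 by exact: leq_b1.
have dU (A B : {set V}) : [disjoint A & B] -> #|A :|: B|.*2 = #|A|.*2 + #|B|.*2.
  by move=> D; rewrite cardsU disjoint_setI0 // cards0 subn0 doubleD.
case: ifP => _.
  apply: ltnW; elim: t wt => [v|l Hl r Hr] /=.
    by rewrite /heavy_nodes /= cards1 addn0 ltnS leq_b1.
  case/and3P=> /Hl wl /Hr wr D; rewrite heavy_nodes_Node /= dU //.
  apply: leq_ltn_trans (leq_add (leqnn _) (hi_le _ _)) _.
  by rewrite addn1 -addSn; apply: leq_trans (leq_add wl wr) ; rewrite addnS.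
suff : heavy_edges i./2 t + 2 <= #|lset t|.*2 by apply: leq_trans; exact: leq_addr.
elim: t wt => [v|l Hl r Hr] /=; first by rewrite cards1.
case/and3P=> /Hl wl /Hr wr D; rewrite dU //; apply: leq_trans (leq_add wl wr).
move: (hi_le i./2 (lset l)) (hi_le i./2 (lset r)) (hi_le i./2 (lset l :|: lset r)).
move: (heavy _ _) (heavy _ (lset r)) (heavy _ (lset l)) (heavy_edges _ l) (heavy_edges _ r).
by case=> [|[]] // b c d e; rewrite ?mul1n ?mul0n; lia.
Qed.

(** The rest of the tree sees a subtree only through its leaf set, so each rank changes by the same
    amount as inside the subtree. *)
Lemma replace_subtree x x' t : below 0 x t -> wf t -> wf x' -> lset x' = lset x ->
  exists t', [/\ wf t', lset t' = lset t &
    forall i, rank i t' + rank i x = rank i t + rank i x'].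
Proof.
move=> bl wt wx' Ex; elim: bl wt => [_ _|z y c _ Ez _ IH wz].
  by exists x'; split=> // i; rewrite addnC.
have [wy wc D] : [/\ wf y, wf c & [disjoint lset y & lset c]].
  by move: wz; case: Ez => -> /= /and3P[-> ->]; rewrite // disjoint_sym.
have [t' [wt' Lt' Ht']] := IH wy.
exists (Node t' c); split=> [||i]; first by rewrite /= wt' wc Lt'.
  by case: Ez => -> /=; rewrite Lt' // setUC.
have E u : rank i (Node u c) = rank i u + rank i c +
   (if odd i then heavy i./2 (lset u :|: lset c) else
     heavy i./2 (lset u :|: lset c) * (heavy i./2 (lset u) + heavy i./2 (lset c))).
  by rewrite /rank; case: ifP => _; rewrite ?heavy_nodes_Node.
have -> : rank i z = rank i (Node y c).
  case: Ez => -> //; rewrite /rank !heavy_nodes_Node /= setUC [heavy_nodes _ c + _]addnC.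
  by rewrite [heavy_edges _ c + _]addnC [heavy _ (lset c) + _]addnC.
rewrite !E Lt'; move: (Ht' i) (if odd i then _ else _); clear.
by move: (rank i t') (rank i x) (rank i y) (rank i x') (rank i c) => *; lia.
Qed.

Lemma base_lt_expn (B n : nat) (a : nat -> nat) :
  (forall i, a i < B) -> \sum_(i < n) a i * B ^ i < B ^ n.
Proof.
move=> aB; elim: n => [|n IH]; first by rewrite big_ord0 expn0.
rewrite big_ord_recr /= expnS; apply: leq_trans (_ : (a n).+1 * B ^ n <= _).
  by rewrite mulSn ltn_add2r.
by rewrite leq_mul2r aB orbT.
Qed.

Lemma base_lex (B n j : nat) (a b : nat -> nat) :
  (forall i, a i < B) -> j < n -> a j < b j -> (forall i, j < i -> a i <= b i) ->
  \sum_(i < n) a i * B ^ i < \sum_(i < n) b i * B ^ i.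
Proof.
move=> aB jn abj H; elim: n jn => // n IH; rewrite ltnS leq_eqVlt => /orP[/eqP<-|jn].
  rewrite !big_ord_recr /=; apply: leq_trans (leq_addl _ _).
  apply: leq_trans (_ : (a j).+1 * B ^ j <= _); last by rewrite leq_mul2r abj orbT.
  by rewrite mulSn ltn_add2r base_lt_expn.
rewrite !big_ord_recr /= -addSn leq_add ?IH // leq_mul2r H ?orbT //.
Qed.

Lemma rank_nodes k t : rank k.+1.*2.+1 t = 0 <-> {in nodes t, forall A, f A <= k}.
Proof.
rewrite /rank /= odd_double /= uphalf_double; split=> [M0 A HA|H].
  rewrite leqNgt; apply/negP => kA; suff : 0 < heavy_nodes k.+1 t by rewrite M0.
  by rewrite heavy_nodes_gt0; apply/hasP; exists A.
have := @rank0 k.+1.*2.+1 k t H; rewrite /rank /= odd_double /= uphalf_double.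
exact.
Qed.

(** Ranks are digits below [B] and vanish from index [n] on, so the lexicographic order is that of
    the numbers [phi], and improvement must stop; a tree that cannot be improved is linked. *)
Lemma linked_tree_exists k t : wf t -> {in nodes t, forall A, f A <= k} ->
  exists t', [/\ wf t', lset t' = lset t, linked t' & {in nodes t', forall A, f A <= k}].
Proof.
pose B := #|V|.*2.+1; pose n := k.+1.*2.
pose phi t := \sum_(i < n) rank i t * B ^ i.
have [m] := ubnP (phi t); elim: m t => // m IH t; rewrite ltnS => phim wt tk.
have [lt|nl] := classic (linked t); first by exists t.
have [x [y [X [bx byx Ey [yX Xx] lt0]]]] : exists x y X, [/\ below 0 x t,
   below (f (lset x)) y x, f (lset y) = f (lset x),
   lset y \subset X /\ X \subset lset x & f X < f (lset x)].
  apply: NNPP => nx; case: nl => x y X bx byx E yX Xx; rewrite leqNgt.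
  apply/negP=> lt1.
  by apply: nx; exists x, y, X.
have wx := below_wf bx wt.
have [x' [wx' Ex' [j lj gj]]] := improve wx byx (eq_leq (esym Ey)) yX Xx lt0.
have [t' [wt' Et' Ht']] := replace_subtree bx wt wx' Ex'.
have ltj : rank j t' < rank j t by move: (Ht' j) lj; clear; lia.
have gtj i : j < i -> rank i t' <= rank i t by move/gj; move: (Ht' i); clear; lia.
have jn : j < n.
  rewrite ltnNge; apply: contraTN ltj => nj; rewrite -leqNgt (@rank0 j k t) //.
  by rewrite geq_half_double.
(* The bound [k] is itself the vanishing of a rank, and the index of that rank lies above [j]. *)
have tk' : {in nodes t', forall A, f A <= k}.
  apply/rank_nodes; apply/eqP; rewrite -leqn0 -(iffRL (rank_nodes k t) tk).
  by apply: gtj; exact: ltnW.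
have [|t'' [wt'' Et'' lt'' tk'']] := IH t' _ wt' tk'; last first.
  by exists t''; split; rewrite ?Et''.
apply: leq_trans phim; apply: (@base_lex B n j (rank^~ t') (rank^~ t)) => // i.
by rewrite ltnS (leq_trans (rank_le i wt')) // leq_double max_card.
Qed.
End LinkedTree.

(** * Edge-disjoint linkages in balanced digraphs *)

Section Linkage.
Variables (V E : finType) (tl : E -> V).
Implicit Types (hd : E -> V) (D : {set E}) (x y X Z : {set V}) (e f g : E) (p q : seq E).

(** Tails are fixed while [hd] and [D] are arguments, because splitting off redirects one head and
    deletes one edge within the same edge type. *)
Definition balanced hd D := forall v,
  \sum_(e in D) (tl e == v) = \sum_(e in D) (hd e == v).
Definition outs hd D X := [set e in D | (tl e \in X) && (hd e \notin X)].
Definition ins hd D X := [set e in D | (tl e \notin X) && (hd e \in X)].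

Lemma card_outs hd D X : balanced hd D -> #|outs hd D X| = #|ins hd D X|.
Proof.
move=> bal; have inX (k : E -> V) : \sum_(e in D) (k e \in X) =
    \sum_(v in X) \sum_(e in D) (k e == v).
  rewrite exchange_big; apply: eq_bigr => e _ /=.
  have [kX|kX] := boolP (k e \in X); last first.
    by rewrite big1 // => v vX; case: eqP => // kv; rewrite kv vX in kX.
  rewrite (bigD1 (k e)) //= eqxx big1 // => v /andP[_].
  by rewrite eq_sym => /negbTE->.
have out : #|outs hd D X| + \sum_(e in D) ((tl e \in X) && (hd e \in X)) =
    \sum_(e in D) (tl e \in X).
  rewrite -sum1_card [X in X + _](eq_bigl (fun e => (e \in D) && ((tl e \in X) && (hd e \notin X)))).
    rewrite big_mkcondr -big_split /=; apply: eq_bigr => e _.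
    by case: (tl e \in X); case: (hd e \in X).
  by move=> e; rewrite inE.
have inn : #|ins hd D X| + \sum_(e in D) ((tl e \in X) && (hd e \in X)) =
    \sum_(e in D) (hd e \in X).
  rewrite -sum1_card [X in X + _](eq_bigl (fun e => (e \in D) && ((tl e \notin X) && (hd e \in X)))).
    rewrite big_mkcondr -big_split /=; apply: eq_bigr => e _.
    by case: (tl e \in X); case: (hd e \in X).
  by move=> e; rewrite inE.
have E0 : \sum_(e in D) (tl e \in X) = \sum_(e in D) (hd e \in X).
  by rewrite !inX; apply: eq_bigr => v _; apply: bal.
by apply/eqP; rewrite -(eqn_add2r (\sum_(e in D) ((tl e \in X) && (hd e \in X)))) out inn E0.
Qed.

Definition inner hd p := if p is e :: q then [seq hd f | f <- belast e q] else [::].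
Definition trail hd D (Z : {set V}) p := if p is e :: q then
  [&& uniq p, path [rel e1 e2 | hd e1 == tl e2] e q, all (mem D) p &
      all (mem Z) (inner hd p)] else false.

(** Indexing by the boundary of [y] serves both directions: a trail starts at its index if this
    leaves [y] and ends at it if this enters [y]. Disjointness is required across the two directions
    too. *)
Definition link hd D y x (P : E -> seq E) :=
  [/\ forall e, e \in outs hd D y ->
        [/\ trail hd D (x :\: y) (P e), seq.head e (P e) = e & last e (P e) \in outs hd D x],
      forall e, e \in ins hd D y ->
        [/\ trail hd D (x :\: y) (P e), last e (P e) = e & seq.head e (P e) \in ins hd D x]
    & forall e f, e \in outs hd D y :|: ins hd D y -> f \in outs hd D y :|: ins hd D y ->
        e != f -> forall g, g \in P e -> g \notin P f].

Lemma inner_hd hd e q g : g \in e :: q -> g = last e q \/ hd g \in inner hd (e :: q).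
Proof.
move=> gq; have : g \in rcons (belast e q) (last e q) by rewrite -lastI.
rewrite mem_rcons inE => /orP[/eqP|ge]; [by left|right].
by rewrite /inner map_f.
Qed.

Lemma inner_tl hd e q g : path [rel a b | hd a == tl b] e q -> g \in e :: q ->
  g = e \/ tl g \in inner hd (e :: q).
Proof.
move=> pq; rewrite inE => /orP[/eqP|gq]; [by left|right; rewrite /inner].
elim: q e pq gq => // f q IH e /= /andP[/eqP E0 pq]; rewrite inE => /orP[/eqP->|gq].
  by rewrite E0 mem_head.
by rewrite inE IH ?orbT.
Qed.

Lemma trail_hd hd D Z p e0 g : trail hd D Z p -> g \in p ->
  g = last e0 p \/ hd g \in Z.
Proof. by case: p => // e q /and4P[_ _ _ /allP H] /(inner_hd hd)[|/H]; auto. Qed.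

Lemma trail_tl hd D Z p e0 g : trail hd D Z p -> g \in p ->
  g = seq.head e0 p \/ tl g \in Z.
Proof. by case: p => // e q /and4P[_ pq _ /allP H] /(inner_tl pq)[|/H]; auto. Qed.

Lemma trail_cat hd D Z1 Z2 Z p q e0 : trail hd D Z1 p -> trail hd D Z2 q ->
  last e0 p = seq.head e0 q -> Z1 \subset Z -> Z2 \subset Z ->
  (forall g, g \in p -> g \notin behead q) ->
  trail hd D Z (p ++ behead q) /\ last e0 (p ++ behead q) = last e0 q.
Proof.
case: p => // a p; case: q => // b q /and4P[u1 p1 D1 /allP H1] /and4P[u2 p2 D2 /allP H2].
move=> E0 S1 S2 dis; rewrite /= in E0; split; last by rewrite /= last_cat E0.
rewrite /= in dis; apply/and4P; split.
- rewrite -?cat_cons cat_uniq u1 /=; move: u2; rewrite cons_uniq => /andP[_ ->]; rewrite andbT -all_predC.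
  by apply/allP => g gq; apply: contraL (gq); apply: dis.
- by rewrite cat_path p1 E0.
- by rewrite -?cat_cons all_cat D1; move: D2 => /= /andP[].
- rewrite [inner _ _]/= belast_cat map_cat E0 all_cat; apply/andP; split; apply/allP => v.
    by move/H1/(subsetP S1).
  by move/H2/(subsetP S2).
Qed.

(** Trails of [P] have their inner vertices in [X :\: y], those of [Q] in [x :\: X], so they share
    only boundary edges of [X]. The joining edge ends one trail and starts the other, and [behead]
    removes the duplicate. *)
Lemma link_trans hd D y X x P Q : y \subset X -> X \subset x ->
  link hd D y X P -> link hd D X x Q -> exists R, link hd D y x R.
Proof.
move=> yX Xx [Po Pi Pd] [Qo Qi Qd].
have S1 : X :\: y \subset x :\: y by apply: setSD.
have S2 : x :\: X \subset x :\: y by apply: setDS.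
(* The boundary edge of [X] that the trail of [e] reaches, or comes from if [e] enters [y]. *)
pose jun e := if tl e \in y then last e (P e) else seq.head e (P e).
pose cut Y := outs hd D Y :|: ins hd D Y.
have cutP Y e : e \in cut Y -> e \in outs hd D Y /\ tl e \in Y \/ e \in ins hd D Y /\ (tl e \in Y) = false.
  rewrite inE => /orP[]H; [left|right]; split=> //; move: H; rewrite inE => /and3P[_ H _] //.
  exact/negbTE.
have junX e : e \in cut y -> jun e \in cut X /\ (tl (jun e) \in X) = (tl e \in y).
  case/cutP=> -[He Ey]; rewrite /jun Ey inE.
    have [_ _ H] := Po e He; rewrite H; split=> //; move: H; rewrite inE.
    by case/and3P => _ ->.
  have [_ _ H] := Pi e He; rewrite H orbT; split=> //; move: H; rewrite inE.
  by case/and3P => _ /negbTE->.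
have tP e : e \in cut y -> trail hd D (X :\: y) (P e).
  by case/cutP=> -[He _]; [have [] := Po e He|have [] := Pi e He].
have tQ e : e \in cut X -> trail hd D (x :\: X) (Q e).
  by case/cutP=> -[He _]; [have [] := Qo e He|have [] := Qi e He].
have junP e : e \in cut y -> jun e \in P e.
  by move/tP; rewrite /jun; case: (P e) => // a p _; case: ifP => _ /=; rewrite ?mem_last ?mem_head.
(* A common edge of a trail inside [X] and a trail outside [X] crosses the
   boundary of [X], hence is the edge at which they are joined. *)
have meet e f g : e \in cut y -> f \in cut X -> g \in P e -> g \in Q f -> g = f /\ g = jun e.
  move=> ey fX gP gQ; have hP := trail_hd e (tP e ey) gP; have lP := trail_tl e (tP e ey) gP.
  have hQ := trail_hd f (tQ f fX) gQ; have lQ := trail_tl f (tQ f fX) gQ.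
  have nX v : v \in x :\: X -> v \in X = false by rewrite inE => /andP[/negbTE].
  have yX' v : v \in X :\: y -> v \in X by rewrite inE => /andP[].
  rewrite /jun; case/cutP: ey => -[He Ey]; rewrite Ey; case/cutP: fX => -[Hf Ef].
  - have [_ E1 E2] := Po e He; have [_ E3 E4] := Qo f Hf.
    rewrite E1 in lP; rewrite E3 in lQ.
    have gX : tl g \in X by case: lP => [->|/yX' //]; exact: (subsetP yX).
    have gf : g = f by case: lQ => // /nX; rewrite gX.
    split=> //; case: hP => // /yX'; rewrite gf.
    by move: Hf; rewrite inE => /and3P[_ _ /negbTE->].
  - have [_ E1 E2] := Po e He; have [_ E3 E4] := Qi f Hf.
    rewrite E1 in lP.
    have gX : tl g \in X by case: lP => [->|/yX' //]; exact: (subsetP yX).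
    case: lQ => [Eg|/nX]; last by rewrite gX.
    move: E4; rewrite -Eg inE => /and3P[_ /negP[]]; exact: (subsetP Xx).
  - have [_ E1 E2] := Pi e He; have [_ E3 E4] := Qo f Hf.
    rewrite E1 in hP.
    have gX : hd g \in X.
      case: hP => [->|/yX' //]; apply: (subsetP yX).
      by move: He; rewrite inE => /and3P[].
    case: hQ => [Eg|/nX]; last by rewrite gX.
    move: E4; rewrite -Eg inE => /and3P[_ _ /negP[]]; exact: (subsetP Xx).
  - have [_ E1 E2] := Pi e He; have [_ E3 E4] := Qi f Hf.
    rewrite E1 in hP; rewrite E3 in hQ.
    have gX : hd g \in X.
      case: hP => [->|/yX' //]; apply: (subsetP yX).
      by move: He; rewrite inE => /and3P[].
    have gf : g = f by case: hQ => // /nX; rewrite gX.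
    split=> //; case: lP => // /yX'; rewrite gf.
    by move: Hf; rewrite inE => /and3P[_ /negbTE->].
exists (fun e => if tl e \in y then P e ++ behead (Q (jun e)) else Q (jun e) ++ behead (P e)).
split.
- move=> e He; have ey : e \in cut y by rewrite inE He.
  have [jX _] := junX e ey.
  case/cutP: (ey) => -[He' Ey]; last first.
    by move: He; rewrite inE Ey andbF.
  rewrite Ey; have [t1 E1 E2] := Po e He.
  have Ej : jun e = last e (P e) by rewrite /jun Ey.
  rewrite -Ej in E2; have [t2 E3 E4] := Qo _ E2.
  have EL : last e (P e) = seq.head e (Q (jun e)).
    by rewrite -Ej -{1}E3; case: (Q (jun e)) t2.
  case: (trail_cat t1 t2 EL S1 S2) => [g gP|tr la].
    apply/negP=> gQ; have [] := meet e (jun e) g ey jX gP _.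
      by case: (Q (jun e)) gQ => //= a q gq; rewrite inE gq orbT.
    move=> gj _; move: t2 E3 gQ; case: (Q (jun e)) => //= a q /and4P[/andP[aq _] _ _ _].
    by move=> Ea; rewrite gj -{1}Ea (negbTE aq).
  split=> //; first by case: (P e) t1 E1.
  rewrite la; move: E4; by case: (Q _) t2.
- move=> e He; have ey : e \in cut y by rewrite inE He orbT.
  have [jX _] := junX e ey.
  case/cutP: (ey) => -[He' Ey].
    by move: He; rewrite inE Ey andbF.
  rewrite Ey; have [t1 E1 E2] := Pi e He.
  have Ej : jun e = seq.head e (P e) by rewrite /jun Ey.
  rewrite -Ej in E2; have [t2 E3 E4] := Qi _ E2.
  have EL : last e (Q (jun e)) = seq.head e (P e).
    by rewrite -Ej -{2}E3; case: (Q (jun e)) t2.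
  case: (trail_cat t2 t1 EL S2 S1) => [g gQ|tr la].
    apply/negP=> gP; have [] := meet e (jun e) g ey jX _ gQ.
      by case: (P e) gP => //= a q gq; rewrite inE gq orbT.
    move=> _ gj; move: t1 gP; rewrite gj Ej; case: (P e) => //= a q /and4P[/andP[aq _] _ _ _].
    by rewrite (negbTE aq).
  split=> //; first by rewrite la.
  by move: E4; case: (Q _) t2.
- move=> e f ey fy nef g.
  have [je _] := junX e ey; have [jf _] := junX f fy.
  have subR h k : k \in (if tl h \in y then P h ++ behead (Q (jun h))
       else Q (jun h) ++ behead (P h)) -> k \in P h \/ k \in Q (jun h).
    have bh (s : seq E) : k \in behead s -> k \in s by exact: mem_behead.
    by case: ifP => _; rewrite mem_cat => /orP[]; auto.
  have nj : jun e != jun f.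
    apply/negP=> /eqP jj; have := Pd e f ey fy nef (jun e) (junP e ey).
    by rewrite jj (junP f fy).
  move=> /subR ge; apply/negP => /subR gf; case: ge gf => ge [] gf.
  + by have := Pd e f ey fy nef g ge; rewrite gf.
  + have [gj _] := meet e (jun f) g ey jf ge gf.
    by have := Pd e f ey fy nef g ge; rewrite gj junP.
  + have [gj _] := meet f (jun e) g fy je gf ge.
    have := Pd f e fy ey _ g gf; rewrite eq_sym => /(_ nef).
    by rewrite gj junP.
  + by have := Qd _ _ je jf nj g ge; rewrite gf.
Qed.


(** * Splitting off a pair of edges at an inner vertex *)

Section SplitOff.
Variables (hd : E -> V) (D : {set E}) (v : V) (e1 e2 : E).
Hypotheses (D1 : e1 \in D) (D2 : e2 \in D).
Hypotheses (h1 : hd e1 = v) (t2 : tl e2 = v) (t1 : tl e1 != v).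

(* [e2] is deleted and [e1] redirected to its head; [lift] undoes this. *)
Definition split_head e := if e == e1 then hd e2 else hd e.
Definition split_edges := D :\ e2.

Let ne : e1 != e2.
Proof. by apply: contraNneq t1 => ->; rewrite t2. Qed.

Lemma split_edges_card : #|split_edges| < #|D|.
Proof. by rewrite [#|D|](cardsD1 e2) D2. Qed.

Lemma balanced_split : balanced hd D -> balanced split_head split_edges.
Proof.
move=> bal z; have := bal z.
rewrite (bigD1 e2) //= [X in _ = X](bigD1 e2) //= [X in _ = _ + X](bigD1 e1) /=; last by rewrite D1 ne.
have E0 (F : E -> nat) : \sum_(e in split_edges) F e = \sum_(e in D | e != e2) F e.
  by apply: eq_bigl => e; rewrite !inE andbC.
rewrite !E0 [X in _ = X -> _]addnA t2 h1 [_ + (v == z)]addnC -addnA => /addnI ->.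
rewrite [RHS](bigD1 e1) /=; last by rewrite D1 ne.
rewrite /split_head eqxx; congr (_ + _); apply: eq_bigr => e /andP[_ /negbTE->] //.
Qed.

(** Only [e2] can be lost if [v] is in [X], and only [e1] if it is not. Hence a set with one
    outgoing edge to spare stays large enough. *)
Lemma split_outs_le X : #|outs hd D X| <= #|outs split_head split_edges X|.+1.
Proof.
have [vX|vX] := boolP (v \in X).
  apply: leq_trans (_ : #|e2 |: outs split_head split_edges X| <= _); last by rewrite cardsU1; case: (_ \in _).
  apply/subset_leq_card/subsetP => e; rewrite !inE /split_head => /and3P[eD te he].
  case: eqP => //= _; rewrite eD te /=; case: eqP => // Ee.
  by move: he; rewrite Ee h1 vX.
apply: leq_trans (_ : #|e1 |: outs split_head split_edges X| <= _); last by rewrite cardsU1; case: (_ \in _).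
apply/subset_leq_card/subsetP => e; rewrite !inE /split_head => /and3P[eD te he].
case: eqP => //= _; rewrite eD te he !andbT; apply/eqP => Ee.
by move: te; rewrite Ee t2 (negbTE vX).
Qed.

(** With [v] outside [X] the set of outgoing edges does not change at all, while among the incoming
    ones [e1] may replace [e2]. So [y] is controlled through [outs] and [x], which contains [v],
    through [ins]. *)
Lemma split_outs X : v \notin X -> ~~ ((tl e1 \in X) && (hd e2 \in X)) ->
  outs split_head split_edges X = outs hd D X.
Proof.
move=> vX nX; apply/setP => e; rewrite !inE /split_head.
have [->|_] := eqVneq e e2; first by rewrite t2 (negbTE vX) /= andbF.
case: eqP => [->|//]; rewrite h1 vX D1 /=.
by case: (tl e1 \in X) nX => //= ->.
Qed.

Lemma split_ins X : v \in X -> ~~ ((tl e1 \notin X) && (hd e2 \notin X)) ->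
  ins split_head split_edges X = ins hd D X.
Proof.
move=> vX nX; apply/setP => e; rewrite !inE /split_head.
have [->|_] := eqVneq e e2; first by rewrite t2 vX /= andbF.
case: eqP => [->|//]; rewrite h1 vX D1 /=.
by case: (tl e1 \in X) nX => //= /negbNE ->.
Qed.

Fixpoint lift p := if p is e :: q then
  if e == e1 then e1 :: e2 :: lift q else e :: lift q else [::].

Lemma mem_lift p g : g \in lift p -> g \in p \/ g = e2 /\ e1 \in p.
Proof.
elim: p => //= e q IH; case: (eqVneq e e1) => [->|_]; rewrite !inE.
  by case/or3P=> [/eqP->|/eqP->|/IH[->|[-> ->]]]; rewrite ?eqxx ?orbT; auto.
by case/orP=> [/eqP->|/IH[->|[-> ->]]]; rewrite ?eqxx ?orbT; auto.
Qed.

Lemma head_lift p e0 : seq.head e0 (lift p) = seq.head e0 p.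
Proof. by case: p => //= e q; case: eqP => [->|]. Qed.

Lemma last_lift p e0 : p != [::] ->
  last e0 (lift p) = if last e0 p == e1 then e2 else last e0 p.
Proof.
case: p => // e q _; rewrite /=; elim: q e => /= [|f q IH] e.
  by case: eqP.
by rewrite -IH /=; case: (e == e1); case: (f == e1).
Qed.

Lemma path_lift e q : path [rel a b | split_head a == tl b] e q ->
  path [rel a b | hd a == tl b] e (behead (lift (e :: q))).
Proof.
elim: q e => [|f q IH] e /=; first by case: eqP => //= ->; rewrite h1 t2 eqxx.
case/andP=> ef /IH /= pq.
have E0 : lift (f :: q) = f :: behead (lift (f :: q)) by rewrite /=; case: eqP => // ->.
rewrite -/(lift (f :: q)) E0; move: ef; rewrite /split_head.
by case: (eqVneq e e1) => [->|_] /= ef; rewrite ?h1 ?t2 ?eqxx ef.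
Qed.

Lemma inner_lift e q (Z : {set V}) : v \in Z -> all (mem Z) (inner split_head (e :: q)) ->
  all (mem Z) (inner hd (lift (e :: q))).
Proof.
move=> vZ; elim: q e => [|f q IH] e /=.
  by case: (e == e1) => //=; rewrite h1 vZ.
case/andP=> ef /IH.
have E0 : lift (f :: q) = f :: behead (lift (f :: q)) by rewrite /=; case: eqP => // ->.
rewrite -/(lift (f :: q)) E0; move: ef; rewrite /split_head.
by case: (eqVneq e e1) => [_|_] /= ef ->; rewrite ?h1 ?vZ ef.
Qed.

Lemma uniq_lift p : uniq p -> e2 \notin p -> uniq (lift p).
Proof.
elim: p => //= e q IH /andP[eq uq]; rewrite inE negb_or => /andP[ee e2q].
have nl : e \notin lift q.
  by apply/negP=> /mem_lift[|[Ee _]]; [rewrite (negbTE eq)|rewrite Ee eqxx in ee].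
case: (eqVneq e e1) => [Ee|_] /=; rewrite ?nl ?IH //.
rewrite Ee in nl eq; rewrite inE negb_or nl ne !andbT /=.
by apply/negP=> /mem_lift[|[_]]; [rewrite (negbTE e2q)|rewrite (negbTE eq)].
Qed.

Lemma trail_lift Z p : v \in Z -> trail split_head split_edges Z p -> trail hd D Z (lift p).
Proof.
move=> vZ; case: p => // e q /and4P[u pq /allP Dp iZ].
have e2p : e2 \notin e :: q by apply/negP=> /Dp; rewrite !inE eqxx.
have E0 : lift (e :: q) = e :: behead (lift (e :: q)) by rewrite /=; case: eqP => // ->.
rewrite E0; apply/and4P; split; last by rewrite -E0 inner_lift.
- by rewrite -E0 uniq_lift.
- exact: path_lift.
rewrite -E0; apply/allP => g /mem_lift[/Dp|[->] //]; by rewrite !inE => /andP[].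
Qed.

(** If [e2] enters [y], it is deleted and the redirected [e1] enters [y] in its stead; hence the
    index [e1] for [e2]. The condition at [y] prevents [e1] from being an outgoing edge of [y] at
    the same time, so no trail is used twice. *)
Lemma link_split y x P : v \notin y -> v \in x ->
  ~~ ((tl e1 \in y) && (hd e2 \in y)) -> ~~ ((tl e1 \notin x) && (hd e2 \notin x)) ->
  link split_head split_edges y x P -> link hd D y x (fun e => lift (P (if e == e2 then e1 else e))).
Proof.
move=> vy vx ny nx [Po Pi Pd].
have vZ : v \in x :\: y by rewrite inE vy.
have oy e : e \in outs hd D y -> e != e2 /\ e \in outs split_head split_edges y.
  rewrite split_outs // => ey; split=> //; apply: contraTneq ey => ->.
  by rewrite inE t2 (negbTE vy) andbF.
have iy e : e \in ins hd D y -> e != e1 /\ (if e == e2 then e1 else e) \in ins split_head split_edges y.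
  move=> ey; have ne1 : e != e1.
    by apply: contraTneq ey => ->; rewrite inE h1 (negbTE vy) !andbF.
  split=> //; move: ey; rewrite !inE /split_head.
  case: (eqVneq e e2) => [->|n2]; last by rewrite (negbTE ne1) n2.
  case/and3P=> _ _ hy; rewrite eqxx hy ne D1 andbT /=.
  by move: ny; rewrite hy andbT => ->; rewrite ?eqxx ?hy.
split.
- move=> e /oy[/negbTE n2 /Po[tr he la]]; rewrite n2; split.
  + exact: trail_lift.
  + by rewrite head_lift.
  rewrite last_lift; last by case: (P e) tr.
  move: la; case: (eqVneq (last e (P e)) e1) => [->|nl]; rewrite !inE /split_head.
    by rewrite eqxx => /and3P[_ _ ->]; rewrite D2 t2 vx.
  by rewrite (negbTE nl) => /and3P[/andP[_ ->] -> ->].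
- move=> e /iy[n1 /Pi]; set e' := if _ then _ else _; move=> [tr la he].
  have Pn0 : P e' != [::] by case: (P e') tr.
  have hE a b : seq.head a (P e') = seq.head b (P e') by case: (P e') Pn0.
  have lE a b : last a (P e') = last b (P e') by case: (P e') Pn0.
  split; first exact: trail_lift.
    rewrite last_lift // (lE e e') la /e'; case: (eqVneq e e2) => [->|_]; first by rewrite eqxx.
    by rewrite (negbTE n1).
  rewrite head_lift (hE e e'); move: he.
  case: (eqVneq (seq.head e' (P e')) e1) => [->|nh]; rewrite !inE /split_head.
    by rewrite h1 vx D1 => /and3P[_ ->].
  by rewrite (negbTE nh) => /and3P[/andP[_ ->] -> ->].
pose r e := if e == e2 then e1 else e.
have cut e : e \in outs hd D y :|: ins hd D y -> r e \in outs split_head split_edges y :|: ins split_head split_edges y.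
  by rewrite !in_setU => /orP[/oy[/negbTE n2 H]|/iy[_ H]]; rewrite /r ?n2 H ?orbT.
have e12 e : e \in outs hd D y :|: ins hd D y -> e = e2 -> e1 \in outs hd D y :|: ins hd D y -> False.
  rewrite !in_setU => + Ee; rewrite {e}Ee => /orP[/oy[]|]; first by rewrite eqxx.
  rewrite inE => /and3P[_ _ hy] /orP[|/iy[]]; last by rewrite eqxx.
  by rewrite inE => /and3P[_ ty _]; move: ny; rewrite ty hy.
move=> e f ey fy nef; rewrite -!/(r _).
have nr : r e != r f.
  rewrite /r; case: (eqVneq e e2) => [Ee|_]; case: (eqVneq f e2) => [Ef|_] //.
  - by rewrite Ee Ef eqxx in nef.
  - by apply/eqP=> E0; apply: (e12 e ey Ee); rewrite E0.
  - by apply/eqP=> E0; apply: (e12 f fy Ef); rewrite -E0.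
have dis := Pd _ _ (cut e ey) (cut f fy) nr.
have dis' := Pd _ _ (cut f fy) (cut e ey) (_ : r f != r e); rewrite eq_sym nr in dis'.
have De g h : g \in P h -> h \in outs split_head split_edges y :|: ins split_head split_edges y -> g != e2.
  move=> gh; rewrite inE => /orP[/Po[]|/Pi[]]; case: (P h) gh => // a p gp /and4P[_ _ /allP H _] _ _;
  by have := H g gp; rewrite !inE => /andP[].
move=> g /mem_lift ge; apply/negP=> /mem_lift gf.
case: ge gf => [ge|[Eg ge]] [gf|[Eg' gf]].
- by have := dis g ge; rewrite gf.
- by have := De g _ ge (cut e ey); rewrite Eg' eqxx.
- by have := De g _ gf (cut f fy); rewrite Eg eqxx.
- by have := dis e1 ge; rewrite gf.
Qed.

End SplitOff.

(* Menger's theorem for balanced digraphs, in both directions at once: an edge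
   pair through an inner vertex is split off without creating a smaller cut. *)
Theorem linkage hd D y x : balanced hd D -> y \subset x ->
  #|outs hd D x| = #|outs hd D y| ->
  (forall X, y \subset X -> X \subset x -> #|outs hd D y| <= #|outs hd D X|) ->
  exists P, link hd D y x P.
Proof.
have [m] := ubnP (#|D| + #|x :\: y|); elim: m hd D y x => // m IH hd D y x.
rewrite ltnS => lem bal yx dxy dmin.
have trivial z : outs hd D z = outs hd D y -> ins hd D z = ins hd D y ->
    link hd D y z (fun e => [:: e]).
  move=> Eo Ei; have cutD e : e \in outs hd D y :|: ins hd D y -> e \in D.
    by rewrite !inE => /orP[] /andP[].
  split=> [e ey|e ey|e f _ _ nef g]; last by rewrite !inE => /eqP->.
    by rewrite /= Eo ey cutD // inE ey.
  by rewrite /= Ei ey cutD // inE ey orbT.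
have [Exy|nxy] := eqVneq x y; first by exists (fun e => [:: e]); apply: trivial; rewrite Exy.
(* A tight set strictly between [y] and [x] divides the problem into two smaller ones. Otherwise all
   sets strictly between have an edge to spare, and splitting off is safe. *)
case: (pickP (fun X : {set V} => [&& y \subset X, X \subset x, X != y, X != x
    & #|outs hd D X| == #|outs hd D y|])) => [X /and5P[yX Xx nXy nXx /eqP dX]|no].
  have cX1 : #|X :\: y| < #|x :\: y|.
    apply: proper_card; apply/properP; split; first exact: setSD.
    have /properP[_ [u ux uX]] : X \proper x by rewrite properEneq nXx.
    exists u; rewrite !inE ?ux ?(negbTE uX) ?andbF //.
    by rewrite andbT; apply: contraNN uX; exact: (subsetP yX).
  have cX2 : #|x :\: X| < #|x :\: y|.
    apply: proper_card; apply/properP; split; first exact: setDS.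
    have /properP[_ [u uX uy]] : y \proper X by rewrite properEneq eq_sym nXy.
    by exists u; rewrite !inE ?uX ?uy //= (subsetP Xx).
  have [|//|//|//|Y yY YX|P HP] := IH hd D y X.
  - by apply: leq_trans lem; rewrite ltn_add2l.
  - by apply: dmin => //; apply: subset_trans YX Xx.
  have [|//|//||Y XY Yx|Q HQ] := IH hd D X x.
  - by apply: leq_trans lem; rewrite ltn_add2l.
  - by rewrite dX.
  - by rewrite dX; apply: dmin => //; apply: subset_trans yX XY.
  exact: link_trans HP HQ.
have [v vx vy] : exists2 v, v \in x & v \notin y.
  have /properP[_ [v vx vy]] : y \proper x by rewrite properEneq eq_sym nxy.
  by exists v.
have tight X : y \subset X -> X \subset x -> X != y -> X != x -> #|outs hd D y| < #|outs hd D X|.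
  move=> yX Xx nXy nXx; rewrite ltn_neqAle dmin // andbT eq_sym.
  by have := no X; rewrite yX Xx nXy nXx /= => ->.
pose inv e := [&& e \in D, hd e == v & tl e != v].
pose outv e := [&& e \in D, tl e == v & hd e != v].
pose good (p : E * E) := [&& inv p.1, outv p.2, ~~ ((tl p.1 \in y) && (hd p.2 \in y))
   & ~~ ((tl p.1 \notin x) && (hd p.2 \notin x))].
case: (pickP good) => [[e1 e2] /and4P[/and3P[/= D1 /eqP h1 t1] /and3P[/= D2 /eqP t2 h2] ny nx]|nogood].
  have bal' := balanced_split D1 D2 h1 t2 t1 bal.
  have dy : #|outs (split_head hd e1 e2) (split_edges D e2) y| = #|outs hd D y|.
    by rewrite (split_outs D1 h1 t2).
  have dx : #|outs (split_head hd e1 e2) (split_edges D e2) x| = #|outs hd D x|.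
    by rewrite !card_outs // (split_ins D1 h1 t2).
  have [|//|//||X yX Xx|P HP] := IH (split_head hd e1 e2) (split_edges D e2) y x.
  - by apply: leq_trans lem; rewrite ltn_add2r split_edges_card.
  - by rewrite dx dy.
  - have [->|nXy] := eqVneq X y; first by [].
    have [->|nXx] := eqVneq X x; first by rewrite dx dy dxy.
    rewrite dy -ltnS; apply: leq_trans (tight X yX Xx nXy nXx) _.
    exact: (@split_outs_le _ _ v).
  by eexists; apply: (link_split D1 D2 h1 t2 t1 vy vx ny nx HP).
have io : (exists e, inv e) <-> (exists e, outv e).
  have oE : outs hd D [set v] = [set e | outv e].
    by apply/setP => e; rewrite !inE.
  have iE : ins hd D [set v] = [set e | inv e].
    by apply/setP => e; rewrite !inE /inv [(tl e != v) && _]andbC.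
  have := card_outs [set v] bal; rewrite oE iE => Eq; split=> -[e he].
    have : 0 < #|[set e | outv e]| by rewrite Eq; apply/card_gt0P; exists e; rewrite inE.
    by case/card_gt0P => e'; rewrite inE; exists e'.
  have : 0 < #|[set e | inv e]| by rewrite -Eq; apply/card_gt0P; exists e; rewrite inE.
  by case/card_gt0P => e'; rewrite inE; exists e'.
have yv : y \subset v |: y by apply: subsetUr.
have vyx : v |: y \subset x by rewrite subUset sub1set vx.
(* Without a good pair, each in-edge and out-edge of [v] have their far ends both in [y] or both
   outside [x]. One alternative then holds for all pairs: in the first, adding [v] to [y] lowers the
   cut, in the second, removing [v] from [x] does, against [dmin]. *)
have noin e : ~~ inv e.
  apply/negP => ie; have [o oo] := io.1 (ex_intro _ e ie).
  have bad i w : inv i -> outv w -> (tl i \in y) && (hd w \in y) || (tl i \notin x) && (hd w \notin x).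
    by move=> ii oo'; have := nogood (i, w); rewrite /good /= ii oo' /= -negb_or => /negbFE.
  have [oy|oy] := boolP (hd o \in y).
    have iny i : inv i -> tl i \in y.
      by move=> ii; case/orP: (bad i o ii oo) => /andP[// _]; rewrite (subsetP yx).
    have outy w : outv w -> hd w \in y.
      by move=> ow; case/orP: (bad e w ie ow) => /andP[// tx]; rewrite (subsetP yx) ?iny in tx.
    have : #|outs hd D (v |: y)| < #|outs hd D y|.
      apply: proper_card; apply/properP; split.
        apply/subsetP => f; rewrite !inE negb_or => /and3P[fD /orP[tv|->] /andP[hv hy]].
          by move: hy; rewrite outy // /outv fD tv hv.
        by rewrite fD hy.
      exists e; case/and3P: (ie) => eD /eqP hv _; first by rewrite inE eD iny // hv vy.
      by rewrite !inE hv eqxx /= !andbF.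
    by rewrite ltnNge dmin.
  have outx w : outv w -> hd w \notin x.
    have ix : tl e \notin x.
      by case/orP: (bad e o ie oo) => /andP[// _]; rewrite (negbTE oy).
    move=> ow; case/orP: (bad e w ie ow) => /andP[// ty].
    by rewrite (subsetP yx _ ty) in ix.
  have inx i : inv i -> tl i \notin x.
    move=> ii; case/orP: (bad i o ii oo) => /andP[// _].
    by rewrite (negbTE oy).
  have : #|outs hd D (x :\ v)| < #|outs hd D x|.
    apply: proper_card; apply/properP; split.
      apply/subsetP => f; rewrite !inE negb_and negbK => /and3P[fD /andP[tv tx]].
      rewrite fD tx => /orP[hv|//].
      have : inv f by rewrite /inv fD hv tv.
      by move/inx; rewrite tx.
    exists o; case/and3P: (oo) => oD /eqP tv _; first by rewrite inE oD tv vx (outx o oo).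
    by rewrite !inE tv eqxx /= !andbF.
  rewrite dxy ltnNge dmin ?subD1set // subsetD1 yx /=; exact: vy.
have noout o : ~~ outv o.
  by apply/negP => oo; have [e ie] := io.2 (ex_intro _ o oo); have := noin e; rewrite ie.
(* Only loops are left at [v], so adding it to [y] changes no boundary. As there is no tight set
   strictly between, [v |: y] must be [x]. *)
have Eo : outs hd D (v |: y) = outs hd D y.
  apply/setP => e; rewrite !inE negb_or; have := noin e; have := noout e; rewrite /inv /outv.
  case: (e \in D) => //=; case: (eqVneq (tl e) v) => [->|_]; case: (eqVneq (hd e) v) => [->|_] //=.
  by rewrite (negbTE vy) ?andbF.
have Ei : ins hd D (v |: y) = ins hd D y.
  apply/setP => e; rewrite !inE negb_or; have := noin e; have := noout e; rewrite /inv /outv.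
  case: (e \in D) => //=; case: (eqVneq (tl e) v) => [->|_]; case: (eqVneq (hd e) v) => [->|_] //=.
  by rewrite (negbTE vy) ?andbF.
have [<-|nvx] := eqVneq (v |: y) x; first by exists (fun e => [:: e]); apply: trivial.
have /(tight _ yv vyx)/(_ nvx) : v |: y != y.
  by apply/eqP => E0; move: vy; rewrite -E0 !inE eqxx.
by rewrite Eo ltnn.
Qed.

End Linkage.

(** * Immersion of labelled pieces *)

Section Embedding.
Variable L : eqType.

Definition touches (G : digraph) (A : {set vertex G}) (e : edge G) :=
  (tail e \in A) || (head e \in A).

(* A boundary edge of [A] goes to a path whose outer end is the boundary edge
   of [A'] with the same label. *)
Definition route (G : digraph) (A : {set vertex G}) (a : edge G -> L)
    (G' : digraph) (A' : {set vertex G'}) (a' : edge G' -> L)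
    (h : vertex G -> vertex G') (e : edge G) (p : seq (edge G')) : bool :=
  if p is g :: q then
    [&& uniq p, path [rel e1 e2 | head e1 == tail e2] g q,
        if tail e \in A then tail g == h (tail e)
          else (tail g \notin A') && (a' g == a e),
        if head e \in A then head (last g q) == h (head e)
          else (head (last g q) \notin A') && (a' (last g q) == a e)
      & all (fun v => (v \in A') && (v \notin [set h u | u in A])) (internal p)]
  else false.

(** Only edges touching [A] are routed. Two disjoint pieces thus both route exactly the edges
    between them, and gluing has to reconcile just these. *)
Definition emb (G : digraph) (A : {set vertex G}) (a : edge G -> L)
    (G' : digraph) (A' : {set vertex G'}) (a' : edge G' -> L) : Prop :=
  exists (h : vertex G -> vertex G') (P : edge G -> seq (edge G')),
  [/\ {in A &, injective h}, {in A, forall v, h v \in A'},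
      forall e, touches A e -> route A a A' a' h e (P e)
    & forall e f, touches A e -> touches A f -> e != f ->
        forall g, g \in P e -> g \notin P f].

Section Route.
Variables (G G' : digraph) (A : {set vertex G}) (A' : {set vertex G'}).
Variables (a : edge G -> L) (a' : edge G' -> L) (h : vertex G -> vertex G').

(** Internal vertices of a route lie in [A'], so an edge of it on the boundary of [A'] must be an
    outer end, where the label is prescribed. *)
Lemma route_edge e p g : {in A, forall v, h v \in A'} ->
  touches A e -> route A a A' a' h e p -> g \in p ->
  touches A' g /\ (g \in rho A' -> e \in rho A /\ a' g = a e).
Proof.
move=> hA te; case: p => // k q /and5P[_ pq tk hl /allP iq] gp.
have tg : tail g \in A' \/ (tail e \notin A /\ a' g = a e).
  case: (inner_tl pq gp) => [->|/iq /andP[]]; last by left.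
  case: ifPn tk => [te' /eqP->|te' /andP[_ /eqP]]; [left; exact: hA|by right].
have hg : head g \in A' \/ (head e \notin A /\ a' g = a e).
  case: (inner_hd (@head G') gp) => [->|/iq /andP[]]; last by left.
  case: ifPn hl => [te' /eqP->|te' /andP[_ /eqP]]; [left; exact: hA|by right].
rewrite /touches !inE; case: tg hg => [->|[te' E]] [->|[he' E']] //=; split=> //.
- by move=> _; split=> //; move: te; rewrite /touches (negbTE he') orbF => ->.
- by rewrite orbT.
- by move=> _; split=> //; move: te; rewrite /touches (negbTE te') => /= ->.
- by move: te; rewrite /touches (negbTE te') (negbTE he').
by move: te; rewrite /touches (negbTE te') (negbTE he').
Qed.

Lemma route_first e g q : {in A, forall v, h v \in A'} ->
  touches A e -> route A a A' a' h e (g :: q) ->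
  if tail e \in A then tail g = h (tail e)
  else [/\ tail g \notin A', head g \in A', g \in rho A', e \in rho A & a' g = a e].
Proof.
move=> hA te r; have [tch _] := route_edge hA te r (mem_head _ _).
case/and5P: r => _ _ + _ _; case: ifPn => [_ /eqP //|tA /andP[tg /eqP ag]].
move: tch te; rewrite /touches (negbTE tg) (negbTE tA) /= => hg he.
by rewrite !inE (negbTE tg) (negbTE tA) hg he.
Qed.

Lemma route_last e g q : {in A, forall v, h v \in A'} ->
  touches A e -> route A a A' a' h e (g :: q) ->
  if head e \in A then head (last g q) = h (head e)
  else [/\ head (last g q) \notin A', tail (last g q) \in A', last g q \in rho A',
    e \in rho A & a' (last g q) = a e].
Proof.
move=> hA te r; have [tch _] := route_edge hA te r (mem_last _ _).
case/and5P: r => _ _ _ + _; case: ifPn => [_ /eqP //|tA /andP[tg /eqP ag]].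
move: tch te; rewrite /touches (negbTE tg) (negbTE tA) /= !orbF => hg he.
by rewrite !inE (negbTE tg) (negbTE tA) hg he.
Qed.

End Route.

Lemma emb_trans (G G' G'' : digraph) (A : {set vertex G}) (a : edge G -> L)
    (A' : {set vertex G'}) (a' : edge G' -> L) (A'' : {set vertex G''}) (a'' : edge G'' -> L) :
  emb A a A' a' -> emb A' a' A'' a'' -> emb A a A'' a''.
Proof.
case=> h1 [P1 [i1 m1 r1 d1]] [h2 [P2 [i2 m2 r2 d2]]].
exists (h2 \o h1), (fun e => flatten [seq P2 g | g <- P1 e]).
have tP e g : touches A e -> g \in P1 e -> touches A' g.
  by move=> te gP; have [] := route_edge m1 te (r1 e te) gP.
(* Consecutive edges of a route in [G'] meet at a vertex of [A'], so their own routes meet at its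
   image under [h2]. The concatenation has as internal vertices only these images and the internal
   vertices of the single routes. *)
have flat g q : path [rel e1 e2 | head e1 == tail e2] g q ->
    (forall f, f \in g :: q -> touches A' f) -> all (mem A') (internal (g :: q)) ->
    exists k r, [/\ flatten (map P2 (g :: q)) = k :: r, exists r0, P2 g = k :: r0,
      path [rel e1 e2 | head e1 == tail e2] k r,
      exists k1 r1, P2 (last g q) = k1 :: r1 /\ last k r = last k1 r1
    & forall v, v \in internal (k :: r) -> (exists2 f, f \in g :: q & v \in internal (P2 f))
       \/ exists2 u, u \in internal (g :: q) & v = h2 u].
  elim: q g => [|f q IH] g.
    move=> _ tg _; have := r2 g (tg g (mem_head _ _)); rewrite /= cats0.
    case Eg: (P2 g) => [|k r] // /and5P[_ pr _ _ _]; exists k, r; split=> //; [by exists r|by exists k, r|].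
    by move=> v vi; left; exists g; rewrite ?mem_head ?Eg.
  move=> /= /andP[/eqP gf pq] tg /andP[gA iq].
  have [|k [r [Ef [r0 Ek] pr [k1 [r1' [El Ll]] ir]]]] := IH f pq _ iq.
    by move=> x xf; apply: tg; rewrite inE xf orbT.
  have tg' := tg g (mem_head _ _); have tf : touches A' f by apply: tg; rewrite !inE eqxx orbT.
  case Eg: (P2 g) (r2 g tg') => [|k' r'] // rg.
  have := route_last m2 tg' rg; rewrite gA => hl.
  have := r2 f tf; rewrite Ek => rf; have := route_first m2 tf rf; rewrite -gf gA => hf.
  have Ef' : (k :: r0) ++ flatten (map P2 q) = k :: r by rewrite -Ek -Ef.
  exists k', (r' ++ k :: r); split; first by rewrite Ef'.
  - by exists r'.
  - by rewrite cat_path /= pr andbT hl hf eqxx andbT; case/and5P: rg.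
  - by exists k1, r1'; rewrite last_cat.
  move=> v; rewrite /= belast_cat /= map_cat mem_cat /=.
  rewrite inE => /or3P[vi|/eqP->|/ir[[x xf vx]|[u uf vu]]].
  - by left; exists g; rewrite ?mem_head // Eg.
  - by right; exists (head g); rewrite ?inE ?eqxx // hl.
  - by left; exists x => //; rewrite inE xf orbT.
  - by right; exists u => //; rewrite inE uf orbT.
split.
- by move=> u v uA vA /= /i2 E; apply: i1 => //; apply: E; apply: m1.
- by move=> v vA; apply/m2/m1.
- move=> e te; case EP: (P1 e) (r1 e te) => [|g q] // re.
  have tq f : f \in g :: q -> touches A' f by rewrite -EP; exact: tP.
  have uP : uniq (flatten (map P2 (g :: q))).
    have : uniq (g :: q) by case/and5P: re.
    elim: (g :: q) tq => //= x s IH tq /andP[xs us]; rewrite cat_uniq.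
    have tx := tq x (mem_head _ _).
    have ts f : f \in s -> touches A' f by move=> fs; apply: tq; rewrite inE fs orbT.
    rewrite IH // andbT; apply/andP; split.
      by have := r2 x tx; case: (P2 x) => // k r /and5P[].
    apply/hasPn => y /flattenP[_ /mapP[z zs ->] yz].
    apply/negP => yx; have := d2 x z tx (ts z zs) _ y yx; rewrite yz => H.
    by have: x != z by [apply: contraNneq xs => ->]; move/H.
  have iA : all (mem A') (internal (g :: q)).
    by case/and5P: re => _ _ _ _ /allP H; apply/allP => v /H /andP[].
  have [|k [r [Ef [r0 Ek] pr [k1 [r1' [El Ll]] ir]]]] := flat g q _ tq iA.
    by case/and5P: re.
  rewrite Ef; rewrite Ef in uP.
  have tg := tq g (mem_head _ _); have tl := tq _ (mem_last g q).
  apply/and5P; split=> //.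
  + have fe := route_first m1 te re; have := r2 g tg; rewrite Ek => /(route_first m2 tg).
    move: fe; case: ifP => teA; first by move=> E; rewrite E m1 // => ->.
    by case=> ngA _ _ _ <-; rewrite (negbTE ngA) => -[-> _ _ _ ->]; rewrite eqxx.
  + have fe := route_last m1 te re; have := r2 _ tl; rewrite El => /(route_last m2 tl).
    rewrite Ll; move: fe; case: ifP => teA; first by move=> E; rewrite E m1 // => ->.
    by case=> ngA _ _ _ <-; rewrite (negbTE ngA) => -[-> _ _ _ ->]; rewrite eqxx.
  apply/allP => v /ir[[x xq vx]|[u uq ->]].
    have := r2 x (tq x xq); case: (P2 x) vx => // k' r' vx /and5P[_ _ _ _ /allP/(_ v vx)].
    case/andP=> -> /= ; apply: contraNN => /imsetP[w wA ->].
    by apply/imsetP; exists (h1 w) => //; apply: m1.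
  case/and5P: re => _ _ _ _ /allP/(_ u uq) /andP[uA' uh].
  rewrite m2 //=; apply: contraNN uh => /imsetP[w wA E].
  by apply/imsetP; exists w => //; apply: i2 => //; exact: m1.
move=> e f te tf nef g /flattenP[_ /mapP[x xe ->] gx].
apply/negP => /flattenP[_ /mapP[y yf ->] gy].
have nxy : x != y.
  by apply: contraTneq (xe) => ->; apply: d1 yf; rewrite // eq_sym.
by have := d2 x y (tP e x te xe) (tP f y tf yf) nxy g gx; rewrite gy.
Qed.


(** Records which labels of two boundaries belong to one edge. Equal patterns are what makes
    immersions of two pieces compatible. *)
Definition pat (G : digraph) (A B : {set vertex G}) (a b : edge G -> L) (i j : L) :=
  exists e, [/\ e \in rho A, e \in rho B, a e = i & b e = j].

Lemma pat_sym (G : digraph) (A B : {set vertex G}) (a b : edge G -> L) i j :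
  pat A B a b i j -> pat B A b a j i.
Proof. by case=> e [? ? ? ?]; exists e. Qed.

(** * Gluing immersions of two disjoint pieces *)

Section GlueSide.
Variables (G G' : digraph) (Al Ar : {set vertex G}) (Al' Ar' : {set vertex G'}).
Variables (al ar a : edge G -> L) (al' ar' a' : edge G' -> L).
Variables (hl hr h : vertex G -> vertex G') (Pl Pr : edge G -> seq (edge G')).
Hypotheses (inl : {in rho Al &, injective al}) (inr : {in rho Ar &, injective ar}).
Hypotheses (inl' : {in rho Al' &, injective al'}) (inr' : {in rho Ar' &, injective ar'}).
Hypotheses (ml : {in Al, forall v, hl v \in Al'}) (mr : {in Ar, forall v, hr v \in Ar'}).
Hypotheses (rl : forall e, touches Al e -> route Al al Al' al' hl e (Pl e)).
Hypotheses (rr : forall e, touches Ar e -> route Ar ar Ar' ar' hr e (Pr e)).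
Hypothesis plr : forall i j, pat Al Ar al ar i j <-> pat Al' Ar' al' ar' i j.
Hypotheses (D : [disjoint Al & Ar]) (D' : [disjoint Al' & Ar']).

(** An edge shared by a left and a right route joins [Al'] to [Ar']. The common pattern yields an
    edge of [G] with the same two labels, and injectivity identifies it with both [e] and [f]. *)
Lemma glue_meet e f g : touches Al e -> touches Ar f -> g \in Pl e -> g \in Pr f ->
  [/\ e = f, e \in rho Al, e \in rho Ar, g \in rho Al' & g \in rho Ar'].
Proof.
move=> te tf ge gf; have [tgl Hl] := route_edge ml te (rl te) ge.
have [tgr Hr] := route_edge mr tf (rr tf) gf.
have [gl gr] : g \in rho Al' /\ g \in rho Ar'.
  move: tgl tgr; rewrite /touches !inE.
  case/orP=> gl /orP[] gr; rewrite gl gr ?(disjointFr D' gl) ?(disjointFl D' gr) //;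
    by [move: gr; rewrite (disjointFr D' gl)].
have [el al_e] := Hl gl; have [fr ar_f] := Hr gr.
have [|k [kl kr ke kf]] := (plr (al e) (ar f)).2.
  by exists g.
have ek : e = k by apply: inl => //; rewrite ke.
have fk : f = k by apply: inr => //; rewrite kf.
split=> //; first by rewrite fk.
by rewrite ek.
Qed.

Hypothesis hlE : {in Al, hl =1 h}.
Hypothesis hrE : {in Ar, hr =1 h}.

Lemma image_disj v : v \in Al' -> v \notin [set hl u | u in Al] ->
  v \notin [set h u | u in Al :|: Ar].
Proof.
move=> vA; apply: contraNN => /imsetP[u]; rewrite inE => /orP[ul|ur] E.
  by apply/imsetP; exists u; rewrite ?hlE.
by move: vA; rewrite E -hrE // (disjointFl D' (mr ur)).
Qed.

(** The left route is kept. If it leaves the union, the pattern of [al] against [a] turns agreement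
    of inner labels into agreement of outer ones. *)
Lemma glue_one e : (forall i j, pat Al (Al :|: Ar) al a i j <-> pat Al' (Al' :|: Ar') al' a' i j) ->
  touches Al e -> ~~ touches Ar e ->
  route (Al :|: Ar) a (Al' :|: Ar') a' h e (Pl e).
Proof.
move=> pl te; rewrite /touches negb_or => /andP[tnr hnr].
case Ep: (Pl e) (rl te) => [|g q] // re; apply/and5P.
have outs k : al' k = al e -> k \in rho Al' -> e \in rho Al -> e \in rho (Al :|: Ar) ->
    k \in rho (Al' :|: Ar') /\ a' k = a e.
  move=> E kl el eA; have [|k' [kl' kA' E1 E2]] := (pl (al e) (a e)).1.
    by exists e.
  by have -> : k = k' by apply: inl' => //; rewrite E1.
have := route_first ml te re; have := route_last ml te re.
rewrite !in_setU (negbTE tnr) (negbTE hnr) !orbF => la fi.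
case/and5P: (re) => u p _ _ /allP i; split=> //.
- move: fi; case: ifPn => teA; first by rewrite hlE // => ->.
  case=> ng hg gr er E.
  have eA : e \in rho (Al :|: Ar).
    by move: er; rewrite !inE (negbTE tnr) (negbTE hnr) !orbF.
  have [gA ->] := outs g E gr er eA; rewrite eqxx andbT.
  by move: gA; rewrite !inE hg /=; case: (_ || _).
- move: la; case: ifPn => teA; first by rewrite hlE // => ->.
  case=> ng hg gr er E.
  have eA : e \in rho (Al :|: Ar).
    by move: er; rewrite !inE (negbTE tnr) (negbTE hnr) !orbF.
  have [gA ->] := outs _ E gr er eA; rewrite eqxx andbT.
  by move: gA; rewrite !inE hg /=; case: (_ || _).
by apply/allP => v /i /andP[vA vh]; rewrite inE vA image_disj.
Qed.

Lemma image_disj_r v : v \in Ar' -> v \notin [set hr u | u in Ar] ->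
  v \notin [set h u | u in Al :|: Ar].
Proof.
move=> vA; apply: contraNN => /imsetP[u]; rewrite inE => /orP[ul|ur] E.
  by move: vA; rewrite E -hlE // (disjointFr D' (ml ul)).
by apply/imsetP; exists u; rewrite ?hrE.
Qed.

(** By the pattern of [al] against [ar], the last edge of the left route is the first edge of the
    right one, so the routes overlap in that edge. *)
Lemma glue_two e : tail e \in Al -> head e \in Ar ->
  route (Al :|: Ar) a (Al' :|: Ar') a' h e (Pl e ++ behead (Pr e)).
Proof.
move=> tl hr_; have te : touches Al e by rewrite /touches tl.
have tr : touches Ar e by rewrite /touches hr_ orbT.
have nhl : head e \notin Al by rewrite (disjointFl D hr_).
have ntr : tail e \notin Ar by rewrite (disjointFr D tl).
have meet g := @glue_meet e e g te tr.
case El: (Pl e) (rl te) => [|g q] // re; case Er: (Pr e) (rr tr) => [|g' q'] // re'.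
have := route_last ml te re; rewrite (negbTE nhl) => -[la1 la2 la3 el Ela].
have := route_first mr tr re'; rewrite (negbTE ntr) => -[fi1 fi2 fi3 er Efi].
have [|k [kl kr ke kf]] := (plr (al e) (ar e)).1; first by exists e.
have Ej : last g q = g'.
  have -> : last g q = k by apply: inl' => //; rewrite ke.
  by apply: inr' => //; rewrite kf.
have := route_first ml te re; rewrite tl => Et.
have := route_last mr tr re'; rewrite hr_ => Eh.
case/and5P: re => u p _ _ /allP i; case/and5P: re' => u' p' _ _ /allP i'.
apply/and5P; split.
- rewrite -?cat_cons cat_uniq u; move: u'; rewrite cons_uniq => /andP[g'q' ->].
  rewrite andbT; apply/hasPn => x xq'; apply/negP => xq.
  have xl : x \in Pl e by rewrite El.
  have xr : x \in Pr e by rewrite Er inE xq' orbT.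
  have [_ _ _ _ rx] := meet x xl xr.
  have [_ /(_ rx)[_ Ex]] := route_edge mr tr (rr tr) xr.
  have E : x = g' by apply: inr' => //; rewrite Efi.
  by rewrite -E xq' in g'q'.
- by rewrite cat_path p Ej p'.
- by rewrite inE tl /= -hlE // Et.
- by rewrite inE hr_ orbT /= last_cat Ej -hrE // Eh.
apply/allP => v; rewrite /= belast_cat map_cat mem_cat Ej => /orP[/i|/i'] /andP[vA vh].
  by rewrite inE vA image_disj.
by rewrite inE vA orbT image_disj_r.
Qed.
End GlueSide.

Section Glue.
Variables (G G' : digraph) (Al Ar : {set vertex G}) (Al' Ar' : {set vertex G'}).
Variables (al ar a : edge G -> L) (al' ar' a' : edge G' -> L).
Hypotheses (inl : {in rho Al &, injective al}) (inr : {in rho Ar &, injective ar}).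
Hypotheses (inl' : {in rho Al' &, injective al'}) (inr' : {in rho Ar' &, injective ar'}).
Hypotheses (D : [disjoint Al & Ar]) (D' : [disjoint Al' & Ar']).
Hypothesis plr : forall i j, pat Al Ar al ar i j <-> pat Al' Ar' al' ar' i j.
Hypothesis pl : forall i j, pat Al (Al :|: Ar) al a i j <-> pat Al' (Al' :|: Ar') al' a' i j.
Hypothesis pr : forall i j, pat Ar (Al :|: Ar) ar a i j <-> pat Ar' (Al' :|: Ar') ar' a' i j.

Lemma emb_glue : emb Al al Al' al' -> emb Ar ar Ar' ar' ->
  emb (Al :|: Ar) a (Al' :|: Ar') a'.
Proof.
case=> hl [Pl [il ml rl dl]] [hr [Pr [ir mr rr dr]]].
have prl i j : pat Ar Al ar al i j <-> pat Ar' Al' ar' al' i j.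
  by split=> /pat_sym/plr/pat_sym.
have Ds : [disjoint Ar & Al] by rewrite disjoint_sym.
have Ds' : [disjoint Ar' & Al'] by rewrite disjoint_sym.
pose h v := if v \in Al then hl v else hr v.
have hlE : {in Al, hl =1 h} by move=> v vA; rewrite /h vA.
have hrE : {in Ar, hr =1 h} by move=> v vA; rewrite /h (disjointFl D vA).
pose P e := if touches Al e then
    if touches Ar e then
      if tail e \in Al then Pl e ++ behead (Pr e) else Pr e ++ behead (Pl e)
    else Pl e
  else Pr e.
have memP e g : touches (Al :|: Ar) e -> g \in P e ->
    (touches Al e /\ g \in Pl e) \/ (touches Ar e /\ g \in Pr e).
  rewrite /P => te; case: ifP => [tl|ntl]; last first.
    move=> gr; right; split=> //; move: te ntl; rewrite /touches !inE.
    by case: (tail e \in Al) => //=; case: (head e \in Al) => //=; rewrite orbF.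
  case: ifP => [tr|_ gl]; last by left.
  by case: ifP => _; rewrite mem_cat => /orP[|/mem_behead]; auto.
have meet e f g := @glue_meet _ _ _ _ _ _ _ _ _ _ hl hr Pl Pr inl inr ml mr rl rr plr D' e f g.
exists h, P; split.
- move=> u v; rewrite !inE => /orP[ul|ur] /orP[vl|vr].
  + by rewrite -!hlE //; apply: il.
  + rewrite -hlE // -hrE // => E; have := ml u ul.
    by rewrite E (disjointFl D' (mr v vr)).
  + rewrite -hrE // -hlE // => E; have := ml v vl.
    by rewrite -E (disjointFl D' (mr u ur)).
  + by rewrite -!hrE //; apply: ir.
- by move=> v; rewrite !inE => /orP[vl|vr]; [rewrite -hlE // ml|rewrite -hrE // mr ?orbT].
- move=> e te; rewrite /P; case: ifPn => tl; last first.
    have tr : touches Ar e.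
      move: te tl; rewrite /touches !inE.
      by case: (tail e \in Al) => //=; case: (head e \in Al) => //=; rewrite orbF.
    have := @glue_one _ _ Ar Al Ar' Al' ar a ar' a' hr hl h Pr inr' mr ml rr Ds' hrE hlE e.
    by rewrite ![_ :|: Al]setUC ![_ :|: Al']setUC; apply.
  case: ifPn => tr; last first.
    exact: (@glue_one _ _ Al Ar Al' Ar' al a al' a' hl hr h Pl inl' ml mr rl D' hlE hrE e).
  case: ifPn => tAl.
    have hAr : head e \in Ar by move: tr; rewrite /touches (disjointFr D tAl).
    exact: (@glue_two _ _ Al Ar Al' Ar' al ar a al' ar' a' hl hr h Pl Pr).
  have hAl : head e \in Al by move: tl; rewrite /touches (negbTE tAl).
  have tAr : tail e \in Ar by move: tr; rewrite /touches (disjointFr D hAl) orbF.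
  have := @glue_two _ _ Ar Al Ar' Al' ar al a ar' al' a' hr hl h Pr Pl.
  by rewrite ![_ :|: Al]setUC ![_ :|: Al']setUC; apply.
move=> e f te tf nef g ge; apply/negP => gf.
case: (memP e g te ge) (memP f g tf gf) => -[t1 g1] [] [t2 g2].
- by have := dl e f t1 t2 nef g g1; rewrite g2.
- by have [E _ _ _ _] := meet e f g t1 t2 g1 g2; rewrite E eqxx in nef.
- by have [E _ _ _ _] := meet f e g t2 t1 g2 g1; rewrite E eqxx in nef.
- by have := dr e f t1 t2 nef g g1; rewrite g2.
Qed.
End Glue.

(** * Immersions obtained from linkages and between leaves *)

Lemma rho_outs_ins (G : digraph) (X : {set vertex G}) :
  rho X = outs (@tail G) (@head G) setT X :|: ins (@tail G) (@head G) setT X.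
Proof.
by apply/setP => e; rewrite !inE; case: (tail e \in X); case: (head e \in X).
Qed.

Lemma Eulerian_balanced (G : digraph) :
  Eulerian G -> balanced (@tail G) (@head G) setT.
Proof.
have E (k : edge G -> vertex G) v : \sum_(e in setT) (k e == v) = #|[set e | k e == v]|.
  rewrite -sum1_card (eq_bigl xpredT) => [|e]; last by rewrite inE.
  by rewrite -big_mkcond /=; apply: eq_bigl => e; rewrite inE.
by move=> eul v; rewrite !E; exact: esym (eul v).
Qed.

Lemma card_rho (G : digraph) (X : {set vertex G}) : Eulerian G ->
  #|rho X| = #|outs (@tail G) (@head G) setT X|.*2.
Proof.
move=> /Eulerian_balanced/(card_outs X) E; rewrite rho_outs_ins cardsU -E.
have -> : outs (@tail G) (@head G) [set: edge G] X :&: ins (@tail G) (@head G) setT X = set0.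
  by apply/setP => e; rewrite !inE; case: (tail e \in X); rewrite ?andbF.
by rewrite cards0 subn0 addnn.
Qed.

(** Vertices stay fixed and boundary edges follow the linkage; the internal vertices of its trails
    lie in [x :\: y], hence are not images. The labelling [b] is [a] pulled back along the
    trails. *)
Lemma emb_linkage (G : digraph) (y x : {set vertex G}) (a : edge G -> L) :
  Eulerian G -> y \subset x -> #|rho y| = #|rho x| ->
  (forall X : {set vertex G}, y \subset X -> X \subset x -> #|rho x| <= #|rho X|) ->
  {in rho x &, injective a} ->
  exists2 b : edge G -> L, {in rho y &, injective b} & emb y b x a.
Proof.
move=> eul yx cyx cmin inj; have bal := Eulerian_balanced eul.
have [||P [Po Pi Pd]] := linkage bal yx.
- by apply: double_inj; rewrite -!card_rho.
- by move=> X yX Xx; rewrite -leq_double -!card_rho // cyx cmin.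
rewrite -!rho_outs_ins in Pd.
have rhoP e : e \in rho y -> e \in outs (@tail G) (@head G) setT y /\ tail e \in y /\ head e \notin y \/
    e \in ins (@tail G) (@head G) setT y /\ tail e \notin y /\ head e \in y.
  rewrite rho_outs_ins inE => /orP[] H; [left|right]; split=> //; move: H;
  by rewrite !inE /= => /andP[].
pose fin e := if tail e \in y then last e (P e) else seq.head e (P e).
have finP e : e \in rho y -> fin e \in P e /\ fin e \in rho x.
  move=> /rhoP[[/Po[t _ l] [te _]]|[/Pi[t _ l] [te _]]]; rewrite /fin ?te ?(negbTE te).
    split; last by rewrite rho_outs_ins inE l.
    by case: (P e) t => //= *; exact: mem_last.
  split; last by rewrite rho_outs_ins inE l orbT.
  by case: (P e) t => //= *; exact: mem_head.
exists (a \o fin).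
  move=> e f ey fy /= /inj E; have [e1 e2] := finP e ey; have [f1 f2] := finP f fy.
  apply/eqP; apply: contraT => nef; have := Pd e f ey fy nef (fin e) e1.
  by rewrite E // f1.
exists id, (fun e => if e \in rho y then P e else [:: e]).
have inside e : touches y e -> e \notin rho y -> tail e \in y /\ head e \in y.
  by rewrite /touches !inE; case: (tail e \in y); case: (head e \in y).
have notin e g : e \in rho y -> touches y g -> g \notin rho y -> g \notin P e.
  move=> ey /inside tg ng; have [tg' hg] := tg ng; apply/negP => gP.
  case: (rhoP e ey) => [[/Po[t he _] _]|[/Pi[t he _] _]].
    case: (trail_tl e t gP) => [|]; last by rewrite inE tg'.
    by rewrite he => ge; rewrite ge ey in ng.
  case: (trail_hd e t gP) => [|]; last by rewrite inE hg.
  by rewrite he => ge; rewrite ge ey in ng.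
split=> //.
- by move=> v; exact: (subsetP yx).
- move=> e te; case: ifPn => [ey|ney]; last first.
    by have [t h] := inside e te ney; rewrite /= t h !eqxx.
  have imid : [set id u | u in y] = y by rewrite imset_id.
  case: (rhoP e ey) => [[/Po[t he la] [ty hy]]|[/Pi[t la he] [ty hy]]].
    case Ep: (P e) t he la => [|g q] // /and4P[u p _ /allP i] /= Eg la.
    move: la; rewrite !inE /= => /andP[_ nl]; apply/and5P; split=> //.
    + by rewrite ty Eg.
    + by rewrite (negbTE hy) nl /= /fin ty Ep /= Eg.
    by apply/allP => w /i; rewrite -topredE imid /= inE andbC.
  case Ep: (P e) t he la => [|g q] // /and4P[u p _ /allP i] /= he Eg.
  move: he; rewrite !inE /= => /andP[ng _]; apply/and5P; split=> //.
  + by rewrite (negbTE ty) ng /= /fin (negbTE ty) Ep.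
  + by rewrite hy Eg.
  by apply/allP => w /i; rewrite -topredE imid /= inE andbC.
move=> e f te tf nef g; case: ifPn => ey; case: ifPn => fy.
- exact: Pd.
- by rewrite inE => gP; apply: contraTneq gP => ->; exact: notin.
- by rewrite inE => /eqP->; exact: notin.
by rewrite !inE => /eqP->.
Qed.

(** Values are optional because [U] may be empty, as when the target digraph has no edges. *)
Lemma inj_option (T U : finType) (A : {set T}) (B : {set U}) : #|A| <= #|B| ->
  exists f : T -> option U, {in A, forall x, exists2 y, f x = Some y & y \in B} /\
    {in A &, injective f}.
Proof.
move=> AB; case: (set_0Vmem B) => [B0|[b0 _]].
  exists (fun _ => None); move: AB; rewrite B0 cards0 leqn0 cards_eq0 => /eqP->.
  by split=> x; rewrite ?inE.
have idx x : x \in A -> index x (enum A) < size (enum B).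
  by move=> xA; rewrite -cardE (leq_trans _ AB) // cardE index_mem mem_enum.
exists (fun x => Some (nth b0 (enum B) (index x (enum A)))); split=> [x xA|x y xA yA [/eqP]].
  by eexists; first by []; rewrite -mem_enum mem_nth ?idx.
rewrite nth_uniq ?enum_uniq ?idx // => /eqP E.
by rewrite -(nth_index x (_ : x \in enum A)) ?mem_enum // E nth_index ?mem_enum.
Qed.

Lemma emb_leaf (G G' : digraph) (v : vertex G) (v' : vertex G')
    (a : edge G -> L) (a' : edge G' -> L) :
  {in rho [set v] &, injective a} ->
  (forall e, e \in rho [set v] -> exists e', [/\ e' \in rho [set v'], a' e' = a e
       & (tail e' == v') = (tail e == v)]) ->
  #|[set e : edge G | (tail e == v) && (head e == v)]| <=
    #|[set e : edge G' | (tail e == v') && (head e == v')]| ->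
  emb [set v] a [set v'] a'.
Proof.
move=> inj ex /inj_option[F [FB Finj]].
pose R e e' := [&& e' \in rho [set v'], a' e' == a e & (tail e' == v') == (tail e == v)].
pose P e := if e \in rho [set v] then
   (if [pick e' | R e e'] is Some e' then [:: e'] else [::]) else
   (if F e is Some e' then [:: e'] else [::]).
have Pr e : e \in rho [set v] -> exists2 e', P e = [:: e'] & R e e'.
  move=> er; rewrite /P er; case: pickP => [e' Re|no]; first by exists e'.
  by have [e' [H1 H2 H3]] := ex e er; have := no e'; rewrite /R H1 H2 H3 !eqxx.
have Pl e : touches [set v] e -> e \notin rho [set v] -> [/\ tail e = v, head e = v &
    exists2 e', P e = [:: e'] & F e = Some e' /\ (tail e' = v' /\ head e' = v')].
  move=> te ner; have [t h] : tail e = v /\ head e = v.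
    move: te ner; rewrite /touches !inE.
    by case: (eqVneq (tail e) v) => [->|_]; case: (eqVneq (head e) v) => [->|_].
  split=> //; rewrite /P (negbTE ner).
  have [|e' Fe] := FB e; first by rewrite inE t h eqxx.
  by rewrite inE Fe => /andP[/eqP t' /eqP h']; exists e'.
exists (fun _ => v'), P; split.
- by move=> u w; rewrite !inE => /eqP-> /eqP->.
- by move=> u _; rewrite inE.
- move=> e te; have [er|ner] := boolP (e \in rho [set v]).
    have [e' -> /and3P[r /eqP E]] := Pr e er.
    move: er r; rewrite /= !inE E eqxx !andbT => + + /eqP.
    by case: (tail e == v) => /=; case: (head e == v) => //=;
      case: (tail e' == v') => //=; case: (head e' == v').
  have [t h [e' -> [_ [t' h']]]] := Pl e te ner.
  by rewrite /= !inE t h t' h' !eqxx.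
move=> e f te tf nef g.
have [er|ner] := boolP (e \in rho [set v]); have [fr|nfr] := boolP (f \in rho [set v]).
- have [e' -> /and3P[_ /eqP E1 _]] := Pr e er; have [f' -> /and3P[_ /eqP E2 _]] := Pr f fr.
  rewrite !inE => /eqP->; apply: contraNneq nef => E3.
  by apply/eqP/inj => //; rewrite -E1 -E2 E3.
- have [e' -> /and3P[r _ _]] := Pr e er; have [_ _ [f' -> [_ [t' h']]]] := Pl f tf nfr.
  rewrite !inE => /eqP->; apply: contraTneq r => ->.
  by rewrite !inE t' h' eqxx.
- have [f' -> /and3P[r _ _]] := Pr f fr; have [_ _ [e' -> [_ [t' h']]]] := Pl e te ner.
  rewrite !inE => /eqP->; apply: contraTneq r => <-.
  by rewrite !inE t' h' eqxx.
have [t1 h1 [e' -> [E1 _]]] := Pl e te ner; have [t2 h2 [f' -> [E2 _]]] := Pl f tf nfr.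
rewrite !inE => /eqP->; apply: contraNneq nef => E3.
by apply/eqP/Finj; rewrite ?inE ?t1 ?h1 ?t2 ?h2 ?eqxx // E1 E2 E3.
Qed.

Lemma emb_total (G G' : digraph) (A : {set vertex G}) (A' : {set vertex G'})
    (a : edge G -> L) (a' : edge G' -> L) :
  A = setT -> emb A a A' a' -> strongly_immerses G G'.
Proof.
move=> AT [h [P [i m r d]]]; rewrite {A}AT in i m r d.
have t (e : edge G) : touches setT e by rewrite /touches inE.
exists h, P; split=> [u v|e|e f nef|e v]; [exact: i| | exact: d|].
  have := r e (t e); case: (P e) => // g q /and5P[u p]; rewrite !inE => tg hg _.
  exact/and4P.
have := r e (t e); case: (P e) => // g q /and5P[_ _ _ _ /allP H].
apply/negP => /H /andP[_ /negP[]]; exact: imset_f.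
Qed.
End Embedding.

(** * Well-quasi-orders *)

Lemma choice_fun (A B : Type) (R : A -> B -> Prop) :
  (forall x, exists y, R x y) -> exists f, forall x, R x (f x).
Proof.
move=> H; exists (fun x => proj1_sig (constructive_indefinite_description _ (H x))).
by move=> x; case: constructive_indefinite_description.
Qed.

Definition increasing (phi : nat -> nat) := forall i j, i < j -> phi i < phi j.

Lemma increasing_step (phi : nat -> nat) : (forall n, phi n < phi n.+1) -> increasing phi.
Proof.
by move=> H; apply: (@homo_ltn _ phi (fun a b => a < b)) => // y x z; apply: ltn_trans.
Qed.

Lemma infinite_subseq (P : nat -> Prop) : (forall N, exists2 n, N <= n & P n) ->
  exists phi, increasing phi /\ forall n, P (phi n).
Proof.
move=> H; have [g Hg] : exists g, forall N, N <= g N /\ P (g N).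
  by apply: (@choice_fun _ _ (fun N n => N <= n /\ P n)) => N; have [n] := H N; exists n.
pose phi := fix phi n := if n is m.+1 then g (phi m).+1 else g 0.
exists phi; split; last by case=> [|n]; [have [] := Hg 0|have [] := Hg (phi n).+1].
by apply: (@increasing_step phi) => n; have [] := Hg (phi n).+1.
Qed.

Lemma pigeonhole (T : finType) (c : nat -> T) :
  exists phi t, increasing phi /\ forall n, c (phi n) = t.
Proof.
have [t Ht] : exists t, forall N, exists2 n, N <= n & c n = t.
  apply: NNPP => no; have /fin_all_exists[N HN] : forall t, exists N, forall n, N <= n -> c n <> t.
    move=> t; apply: NNPP => nt; apply: no; exists t => N; apply: NNPP => nN.
    by apply: nt; exists N => n Nn E; apply: nN; exists n.
  by apply: (HN (c (\max_t N t)) (\max_t N t)) => //; apply: leq_bigmax.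
have [phi [inc H]] := infinite_subseq Ht; by exists phi, t.
Qed.

Section Wqo.
Variables (X : Type) (le : X -> X -> Prop).
Hypothesis le_trans : forall x y z, le x y -> le y z -> le x z.

Definition good (x : nat -> X) := exists i j, i < j /\ le (x i) (x j).
Definition wqo (R : X -> Prop) := forall x, (forall i, R (x i)) -> good x.

Lemma good_sub x phi : increasing phi -> good (x \o phi) -> good x.
Proof. by move=> inc [i [j [/inc ij le_ij]]]; exists (phi i), (phi j). Qed.

(** Terms with no later term above them cannot occur infinitely often, since they would form a bad
    sequence. Beyond the last one a chain is built greedily. *)
Lemma wqo_subseq R x : wqo R -> (forall i, R (x i)) ->
  exists phi, increasing phi /\ forall i j, i < j -> le (x (phi i)) (x (phi j)).
Proof.
move=> wR Rx; pose dead i := forall j, i < j -> ~ le (x i) (x j).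
have [N HN] : exists N, forall i, N <= i -> ~ dead i.
  apply: NNPP => no; have [|phi [inc dphi]] := @infinite_subseq dead.
    move=> N; apply: NNPP => nN; apply: no; exists N => i Ni di; apply: nN.
    by exists i.
  have [i [j [ij lij]]] := wR (x \o phi) (fun i => Rx _).
  by apply: (dphi i (phi j)) lij; exact: inc.
have [g Hg] : exists g, forall i, N <= i -> i < g i /\ le (x i) (x (g i)).
  apply: (@choice_fun _ _ (fun i j => N <= i -> i < j /\ le (x i) (x j))) => i; case: (leqP N i) => [Ni|]; last by exists 0.
  apply: NNPP => no; apply: (HN i Ni) => j ij lij; apply: no; by exists j.
have HNg n : N <= iter n g N.
  by elim: n => //= n IH; have [lt _] := Hg _ IH; apply: leq_trans IH (ltnW lt).
exists (fun n => iter n g N); split.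
  by apply: (@increasing_step (fun n => iter n g N)) => n; have [] := Hg _ (HNg n).
apply: (@homo_ltn _ (fun n => x (iter n g N)) le) => [y x' z|n]; last by have [] := Hg _ (HNg n).
exact: le_trans.
Qed.

Lemma wqo_union R S : wqo R -> wqo S -> wqo (fun x => R x \/ S x).
Proof.
move=> wR wS x RSx; case: (classic (forall N, exists2 n, N <= n & R (x n))).
  case/infinite_subseq => phi [inc H]; apply: good_sub inc _; exact: wR.
case/not_all_ex_not => N HN.
have [i [j [ij lij]]] : good (fun n => x (N + n)).
  apply: wS => n; case: (RSx (N + n)) => // Rn; case: HN.
  by exists (N + n); rewrite ?leq_addr.
by exists (N + i), (N + j); rewrite ltn_add2l.
Qed.

Variable size : X -> nat.

(** The Nash-Williams argument: terms are chosen one after another, each of least [size] among bad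
    continuations of the earlier terms. *)
Lemma minimal_bad_sequence (R : X -> Prop) : ~ wqo R ->
  exists x, [/\ forall i, R (x i), ~ good x &
    forall y (idx : nat -> nat), (forall j, R (y j)) ->
      (forall j, le (y j) (x (idx j)) /\ size (y j) < size (x (idx j))) -> good y].
Proof.
move=> nw; have [x0 [Rx0 nx0]] : exists x, (forall i, R (x i)) /\ ~ good x.
  by apply: NNPP => no; apply: nw => x Rx; apply: NNPP => nx; apply: no; exists x.
pose Bad x := (forall i, R (x i)) /\ ~ good x.
pose agree n (x y : nat -> X) := forall i, i < n -> x i = y i.
have step (nx : nat * (nat -> X)) : exists y, Bad nx.2 -> [/\ Bad y, agree nx.1 y nx.2 &
    forall z, Bad z -> agree nx.1 z nx.2 -> size (y nx.1) <= size (z nx.1)].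
  case: nx => n x /=; case: (classic (Bad x)) => [bx|nb]; last by exists x.
  pose P m := exists y, [/\ Bad y, agree n y x & size (y n) = m].
  have : P (size (x n)) by exists x.
  move: {-2}(size (x n)) (leqnn (size (x n))) => m _.
  elim/ltn_ind: m => m IH [y [by_ ay sy]].
  case: (classic (exists2 m', m' < m & P m')) => [[m' lt Pm']|no]; first exact: IH lt Pm'.
  exists y => _; split=> // z bz az; rewrite leqNgt; apply/negP=> lt.
  by apply: no; exists (size (z n)); [rewrite -sy|exists z].
have [F HF] := choice_fun step.
pose xs := fix xs n := F (n, if n is m.+1 then xs m else x0).
pose pre n := if n is m.+1 then xs m else x0.
have xsE n : xs n = F (n, pre n) by case: n.
have bxs n : Bad (pre n).
  by elim: n => [|n IH] //=; rewrite xsE; have [] := HF (n, pre n) IH.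
have agr n d : agree n.+1 (xs (n + d)) (xs n).
  elim: d => [|d IH] i ini; first by rewrite addn0.
  rewrite addnS xsE; have [_ ag _] := HF ((n + d).+1, pre (n + d).+1) (bxs (n + d).+1).
  rewrite ag /=; first exact: IH.
  by rewrite (leq_trans ini) // ltnS leq_addr.
pose x n := xs n n.
have agx n i : i <= n -> x i = xs n i.
  by move=> ile; rewrite /x -{1}(subnKC ile) agr.
have bx : Bad x.
  split=> [i|[i [j [ij lij]]]]; first by case: (bxs i.+1) => H _; exact: H.
  have [_] := bxs j.+1; apply; exists i, j; split=> //=.
  by rewrite -!agx // ltnW.
exists x; split; [by case: bx|by case: bx|].
move=> y idx Ry ley; apply: NNPP => nby.
have [j0 Hj0] : exists j0, forall j, idx j0 <= idx j.
  have : exists m, exists j, idx j = m by exists (idx 0), 0.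
  case=> m; elim/ltn_ind: m => m IH [j Ej].
  case: (classic (exists j', idx j' < m)) => [[j' lt]|no]; first by apply: IH lt _; exists j'.
  by exists j => j'; rewrite Ej leqNgt; apply/negP => lt; apply: no; exists j'.
set n := idx j0 in Hj0.
(* As [n] is the least index used, every term of this tail lies below some [x] with index at least
   [n]. A good pair in [z] would give one in [x] or in [y], yet [z] has a smaller term at place
   [n]. *)
pose z i := if i < n then x i else y (j0 + (i - n)).
have bz : Bad z.
  split=> [i|[i [j [ij]]]]; first by rewrite /z; case: ifP => _ //; case: bx.
  rewrite /z; case: ltnP => [iltn|nlei]; case: ltnP => [jltn|nlej].
  - by move=> lij; case: bx => _; apply; exists i, j.
  - move=> lij; case: bx => _; apply; exists i, (idx (j0 + (j - n))); split.
      by apply: leq_trans iltn _; exact: Hj0.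
    by apply: le_trans lij _; have [] := ley (j0 + (j - n)).
  - by have := leq_trans (ltn_trans ij jltn) nlei; rewrite ltnn.
  - move=> lij; apply: nby; exists (j0 + (i - n)), (j0 + (j - n)); split=> //.
    by rewrite ltn_add2l ltn_sub2r // (leq_ltn_trans nlei).
have [_ _ /(_ z bz)] := HF (n, pre n) (bxs n).
rewrite /= -xsE -/(x n) /z ltnn subnn addn0 leqNgt => /(_ _)/negP[].
  move=> i ltin; rewrite ltin; case: (n) ltin => // m; rewrite ltnS => im.
  by rewrite (agx m).
by have [] := ley j0.
Qed.
End Wqo.

(** * Pieces of bounded width are well-quasi-ordered *)

Lemma emb_relabel (L : eqType) (pi : L -> L) (G G' : digraph) (A : {set vertex G})
    (A' : {set vertex G'}) (a b : edge G -> L) (a' b' : edge G' -> L) :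
  {in rho A, forall e, a e = pi (b e)} -> {in rho A', forall e, a' e = pi (b' e)} ->
  emb A b A' b' -> emb A a A' a'.
Proof.
move=> Ea Ea' [h [P [i m r d]]]; exists h, P; split=> // e te.
case Ep: (P e) (r e te) => [|g q] // re.
have := route_first m te re; have := route_last m te re.
case/and5P: (re) => u p tg hg iq la fi; apply/and5P; split=> //.
- move: fi; case: ifPn => _ => [->//|[-> _ gr er E]]; by rewrite Ea' // Ea // E eqxx.
- move: la; case: ifPn => _ => [->//|[-> _ gr er E]]; by rewrite Ea' // Ea // E eqxx.
Qed.

Section Main.
Variable k : nat.
(** A boundary has at most [k] edges; the extra label keeps the type inhabited for [k = 0]. *)
Notation L := 'I_k.+1.

Definition cut (G : digraph) (X : {set vertex G}) : nat := #|rho X|.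

Definition piece := {G : digraph & btree (vertex G)}.
Definition Piece (G : digraph) (t : btree (vertex G)) : piece := existT _ G t.

Record lpiece := LPiece { up : piece; lab : edge (projT1 up) -> L }.

Definition pset (u : piece) : {set vertex (projT1 u)} := lset (projT2 u).
Definition piece_le (x y : lpiece) := emb (pset (up x)) (@lab x) (pset (up y)) (@lab y).
Definition psize (x : lpiece) := size (nodes (projT2 (up x))).

Lemma piece_le_trans x y z : piece_le x y -> piece_le y z -> piece_le x z.
Proof. exact: emb_trans. Qed.

Definition valid (u : piece) := [/\ Eulerian (projT1 u), wf (projT2 u),
  linked (@cut (projT1 u)) (projT2 u)
  & {in nodes (projT2 u), forall A, cut A <= k}].

Definition labelled (U : piece -> Prop) (x : lpiece) :=
  [/\ U (up x), valid (up x) & {in rho (pset (up x)) &, injective (@lab x)}].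

Definition pwqo (U : piece -> Prop) := wqo piece_le (labelled U).

Lemma wqo_mono (R S : lpiece -> Prop) : (forall x, R x -> S x) -> wqo piece_le S -> wqo piece_le R.
Proof. by move=> RS wS x Rx; apply: wS => i; apply: RS. Qed.

Lemma pwqo_union U W : pwqo U -> pwqo W -> pwqo (fun u => U u \/ W u).
Proof.
move=> wU wW; apply: wqo_mono (wqo_union wU wW) => x [UW v i].
by case: UW => ?; [left|right].
Qed.

Lemma valid_children G l r : valid (@Piece G (Node l r)) -> valid (Piece l) /\ valid (Piece r).
Proof.
case=> /= eul /and3P[wl wr D] lin cw; split; split=> //=.
- move=> x y X bx; apply: lin; apply: Below_node bx => //; by left.
- by move=> A HA; apply: cw; rewrite inE mem_cat HA orbT.
- move=> x y X bx; apply: lin; apply: Below_node bx => //; by right.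
- by move=> A HA; apply: cw; rewrite inE mem_cat HA !orbT.
Qed.

Lemma labels_exist u : valid u -> exists a : edge (projT1 u) -> L, {in rho (pset u) &, injective a}.
Proof.
case=> _ _ _ cw; have ck : #|rho (pset u)| <= k by apply: cw; exact: lset_in_nodes.
exists (fun e => inord (index e (enum (rho (pset u))))) => e f er fr /(congr1 (@nat_of_ord _)).
have idx g : g \in rho (pset u) -> index g (enum (rho (pset u))) < k.+1.
  by move=> gr; rewrite (leq_trans _ (_ : #|rho (pset u)| < k.+1)) // cardE ltnW // ltnS index_mem mem_enum.
rewrite !inordK ?idx // => E.
by rewrite -(nth_index e (_ : e \in enum (rho (pset u)))) ?mem_enum // E nth_index ?mem_enum.
Qed.

Definition patset (G : digraph) (A B : {set vertex G}) (a b : edge G -> L) : {set L * L} :=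
  [set ij | [exists e, [&& e \in rho A, e \in rho B, a e == ij.1 & b e == ij.2]]].

Lemma patsetP G A B a b G' A' B' a' b' : @patset G A B a b = @patset G' A' B' a' b' ->
  forall i j, pat A B a b i j <-> pat A' B' a' b' i j.
Proof.
have patE (H : digraph) (C D : {set vertex H}) c d i j :
    pat C D c d i j <-> (i, j) \in patset C D c d.
  rewrite inE; split=> [[e [h1 h2 h3 h4]]|/existsP[e /and4P[h1 h2 /eqP h3 /eqP h4]]].
    by apply/existsP; exists e; rewrite h1 h2 h3 h4 !eqxx.
  by exists e.
by move=> E i j; rewrite !patE E.
Qed.

Definition glued (x yl yr : lpiece) (tau : {set L * L} * {set L * L} * {set L * L}) : Prop :=
  exists (G : digraph) (l r : btree (vertex G)) (a al ar : edge G -> L),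
  [/\ x = LPiece (up := Piece (Node l r)) a,
      yl = LPiece (up := Piece l) al, yr = LPiece (up := Piece r) ar
    & tau = (patset (lset l) (lset r) al ar,
             patset (lset l) (lset l :|: lset r) al a,
             patset (lset r) (lset l :|: lset r) ar a)].

Lemma glued_ple (U : piece -> Prop) x yl yr x' yl' yr' tau :
  valid (up x) -> valid (up x') ->
  labelled U yl -> labelled U yr -> labelled U yl' -> labelled U yr' ->
  glued x yl yr tau -> glued x' yl' yr' tau -> piece_le yl yl' -> piece_le yr yr' -> piece_le x x'.
Proof.
move=> vx vx' Ll Lr Ll' Lr' [G [l [r [a [al [ar [Ex El Er Et]]]]]]].
move=> [G' [l' [r' [a' [al' [ar' [Ex' El' Er' Et']]]]]]].
subst; case: Et' => p1 p2 p3; case: vx vx' => _ /and3P[_ _ D] _ _ [_ /and3P[_ _ D'] _ _].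
case: Ll Lr Ll' Lr' => _ _ i1 [_ _ i2] [_ _ i3] [_ _ i4].
by apply: emb_glue => //; apply: patsetP.
Qed.

Definition node_of (U : piece -> Prop) (u : piece) : Prop :=
  if projT2 u is Node l r then U (Piece l) /\ U (Piece r) else False.

(** Higman's argument for pairs: the children get any injective labels, the three patterns are made
    constant by the pigeonhole principle, the left children are made a chain, and a good pair of
    right children is glued on. *)
Lemma node_pwqo U : pwqo U -> pwqo (node_of U).
Proof.
move=> wU x Lx.
have step i : exists yt : lpiece * lpiece * ({set L * L} * {set L * L} * {set L * L}),
    [/\ labelled U yt.1.1, labelled U yt.1.2 & glued (x i) yt.1.1 yt.1.2 yt.2].
  case: (x i) (Lx i) => -[G t] a [/= nU vu _]; case: t nU vu a => // l r [Ul Ur] vu a.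
  have [vl vr] := valid_children vu.
  have [al il] := labels_exist vl; have [ar ir] := labels_exist vr.
  exists (LPiece (up := Piece l) al, LPiece (up := Piece r) ar,
     (patset (lset l) (lset r) al ar, patset (lset l) (lset l :|: lset r) al a,
             patset (lset r) (lset l :|: lset r) ar a)).
  by split; [split|split|exists G, l, r, a, al, ar].
have [y Hy] := choice_fun step.
have [phi [tau [inc Htau]]] := pigeonhole (fun i => (y i).2).
have [psi [incp Hpsi]] : exists psi, increasing psi /\
    forall i j, i < j -> piece_le (y (phi (psi i))).1.1 (y (phi (psi j))).1.1.
  by apply: (wqo_subseq piece_le_trans (x := fun i => (y (phi i)).1.1) wU) => i; have [] := Hy (phi i).
have [i [j [ij lij]]] : good piece_le (fun i => (y (phi (psi i))).1.2).
  by apply: wU => i; have [] := Hy (phi (psi i)).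
exists (phi (psi i)), (phi (psi j)); split; first by apply/inc/incp.
have [h1 h2 h3] := Hy (phi (psi i)); have [h4 h5 h6] := Hy (phi (psi j)).
rewrite Htau in h3; rewrite Htau in h6.
have [_ v1 _] := Lx (phi (psi i)); have [_ v2 _] := Lx (phi (psi j)).
apply: (glued_ple v1 v2 h1 h2 h4 h5 h3 h6) => //; exact: Hpsi.
Qed.

(* [t] is a tree of nodes over pieces in [Q]; neither these pieces nor the root
   are subject to the lower bound [p]. *)
Fixpoint composed (Q : piece -> Prop) p (G : digraph) (t : btree (vertex G)) : Prop :=
  Q (Piece t) \/
  if t is Node l r then
    (composed Q p l /\ (Q (Piece l) \/ p <= cut (lset l))) /\
    (composed Q p r /\ (Q (Piece r) \/ p <= cut (lset r)))
  else False.

Definition composed_piece Q p (u : piece) := composed Q p (projT2 u).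

Lemma composed_base (Q : piece -> Prop) p G (t : btree (vertex G)) : Q (Piece t) -> composed Q p t.
Proof. by case: t => *; left. Qed.

(** A child whose boundary has exactly [p] edges becomes a base piece, and any other child outside
    [Q] already has a larger boundary. *)
Lemma composed_succ (Q : piece -> Prop) p u : composed_piece Q p u ->
  composed_piece (fun w => Q w \/ (composed_piece Q p w /\ cut (pset w) = p)) p.+1 u.
Proof.
case: u => G; rewrite /composed_piece /=; set Q' := fun w => _.
elim=> [v|l Hl r Hr] /=; first by case=> // q; left; left.
case=> [q|[[cl ql] [cr qr]]]; first by left; left.
have child c : composed Q p c -> composed Q' p.+1 c -> Q (Piece c) \/ p <= cut (lset c) ->
    composed Q' p.+1 c /\ (Q' (Piece c) \/ p < cut (lset c)).
  move=> cc cc' qc; split=> //; case: qc => [q|]; first by left; left.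
  by rewrite leq_eqVlt => /orP[/eqP E|]; [left; right|right].
by right; split; apply: child; auto.
Qed.

Lemma below_child p G (t l r c : btree (vertex G)) : p <= cut (lset c) ->
  c = l \/ c = r -> below (@cut G) p (Node l r) t -> below (@cut G) p c t.
Proof.
move=> pc cE; elim=> [pn|z x d pz Ez _ IH]; last by apply: Below_node Ez IH.
case: cE pc => -> pc.
  by apply: (@Below_node _ _ _ _ _ l r) => //; [left|apply: Below_refl].
by apply: (@Below_node _ _ _ _ _ r l) => //; [right|apply: Below_refl].
Qed.

Definition relabelled (y z : lpiece) (pi : {ffun L -> L}) : Prop :=
  exists (u : piece) (b a : edge (projT1 u) -> L),
  [/\ y = LPiece b, z = LPiece a & {in rho (pset u), forall e, a e = pi (b e)}].

Lemma relabelled_ple y z y' z' pi :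
  relabelled y z pi -> relabelled y' z' pi -> piece_le y y' -> piece_le z z'.
Proof.
move=> [u [b [a [-> -> E]]]] [u' [b' [a' [-> -> E']]]]; exact: emb_relabel E E'.
Qed.

(** * The induction step from [p.+1] to [p] *)

Section Step.
Variables (Q : piece -> Prop) (p : nat).
Hypothesis wQ : pwqo Q.
Hypothesis IH : forall Q', pwqo Q' -> pwqo (composed_piece Q' p.+1).

Let R (u : piece) := composed_piece Q p u /\ cut (pset u) = p.

Section Bad.
Variable x : nat -> lpiece.
Hypothesis Lx : forall i, labelled R (x i).
Hypothesis xmin : forall y (idx : nat -> nat), (forall j, labelled R (y j)) ->
  (forall j, piece_le (y j) (x (idx j)) /\ psize (y j) < psize (x (idx j))) -> good piece_le y.

(** The boundary bound on the path to the root is what lets [linked] produce an immersion into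
    [x i]. *)
Let S (u : piece) := exists i (t : btree (vertex (projT1 (up (x i))))),
  [/\ u = Piece t, below (@cut _) p t (projT2 (up (x i))),
      size (nodes t) < psize (x i) & composed Q p t /\ cut (lset t) = p].

(** With the labels imposed by the linkage, each such subtree is smaller than its term of [x] and
    lies below it, so [xmin] applies. Its own labels arise from the imposed ones by a map that is
    constant on a subsequence. *)
Lemma subpieces_pwqo : pwqo S.
Proof.
move=> y Ly.
have step j : exists yi : lpiece * {ffun L -> L} * nat,
    [/\ labelled R yi.1.1, piece_le yi.1.1 (x yi.2) /\ psize yi.1.1 < psize (x yi.2)
      & relabelled yi.1.1 (y j) yi.1.2].
  case: (y j) (Ly j) => u a [/= [i [t [Eu bt st [ct et]]]] vu inj].
  subst u; have [[cx ex] [eul wx linx cwx] injx] := Lx i.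
  have [|||b bi eb] := @emb_linkage _ _ (lset t) (pset (up (x i))) (@lab (x i)) eul _ _ _ injx.
  - by apply: nodes_sub; apply: (below_sub bt); exact: lset_in_nodes.
  - by move: ex et; rewrite /cut => -> ->.
  - move=> X tX Xx; apply: (linx (projT2 (up (x i))) t X) => //; first exact: Below_refl.
      by rewrite -/(pset _) ex.
    by rewrite et -/(pset _) ex.
  (* The edge picked is unique as [b] is injective on the boundary; [ord0] fills in for labels
     outside its range. *)
  pose pi : {ffun L -> L} := [ffun c : L => if [pick e in rho (lset t) | b e == c] is Some e then a e else ord0].
  have Rt : R (Piece t) by split.
  have Lb : labelled R (LPiece (up := Piece t) b) by split.
  exists (LPiece (up := Piece t) b, pi, i); split=> //.
  exists (Piece t), b, a; split=> // e er; rewrite ffunE.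
  case: pickP => [f /andP[fr /eqP /bi E]|/(_ e)]; last by rewrite er eqxx.
  by rewrite E.
have [F HF] := choice_fun step.
have [phi [pi [inc Hpi]]] := pigeonhole (fun j => (F j).1.2).
have [||i [j [ij lij]]] := @xmin (fun j => (F (phi j)).1.1) (fun j => (F (phi j)).2).
- by move=> j; have [] := HF (phi j).
- by move=> j; have [] := HF (phi j).
exists (phi i), (phi j); split; first exact: inc.
have [_ _ r1] := HF (phi i); have [_ _ r2] := HF (phi j).
rewrite Hpi in r1; rewrite Hpi in r2; exact: relabelled_ple r1 r2 lij.
Qed.

(** Going down from the root outside [Q], one meets only boundaries of at least [p] edges. A proper
    subtree with exactly [p] of them is in [S], so [x i] is composed at level [p.+1] over [Q] and
    [S], where [IH] applies. *)
Lemma min_sequence_good : good piece_le x.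
Proof.
apply: (IH (pwqo_union wQ subpieces_pwqo)) => i; have [[cx ex] vx injx] := Lx i.
split=> //; set Q' := fun u => _.
suff main t : composed Q p t -> size (nodes t) <= psize (x i) ->
    below (@cut _) p t (projT2 (up (x i))) -> composed Q' p.+1 t.
  by apply: main => //; apply: Below_refl; rewrite -/(pset _) ex.
elim: t => [v|l Hl r Hr] /=; first by case=> // q _ _; left; left.
case=> [q _ _|[[cl ql] [cr qr]]]; first by left; left.
rewrite size_cat => sz bl; right.
have child c : size (nodes c) < psize (x i) -> c = l \/ c = r -> composed Q p c ->
   (below (@cut _) p c (projT2 (up (x i))) -> composed Q' p.+1 c) ->
   Q (Piece c) \/ p <= cut (lset c) ->
    composed Q' p.+1 c /\ (Q' (Piece c) \/ p < cut (lset c)).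
  move=> sc Ec cc Hc [q|pc].
    by split; [apply: composed_base; left|left; left].
  have bc := below_child pc Ec bl.
  split; first exact: Hc.
  move: pc; rewrite leq_eqVlt => /orP[/eqP E|]; last by right.
  by left; right; exists i, c.
have s1 : size (nodes l) < psize (x i).
  by apply: leq_trans sz; rewrite ltnS leq_addr.
have s2 : size (nodes r) < psize (x i).
  by apply: leq_trans sz; rewrite ltnS leq_addl.
split; first exact: child l s1 (or_introl erefl) cl (Hl cl (ltnW s1)) ql.
exact: child r s2 (or_intror erefl) cr (Hr cr (ltnW s2)) qr.
Qed.
End Bad.

(** The minimal bad sequence needs roots of boundary exactly [p], which [linked] compares with the
    inner boundaries. Once these pieces are known to be well-quasi-ordered they join the base, and
    [IH] covers any root. *)
Lemma composed_step : pwqo (composed_piece Q p).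
Proof.
have wR : pwqo R.
  apply: NNPP => /(@minimal_bad_sequence _ _ piece_le_trans psize)[x [Lx bx xmin]].
  exact: bx (min_sequence_good Lx xmin).
apply: wqo_mono (IH (pwqo_union wQ wR)) => x [cx vx ix].
by split=> //; exact: composed_succ.
Qed.
End Step.

(** For [p] above [k] no boundary of a valid piece is large enough, so the children of a composed
    node both lie in [Q]. *)
Lemma composed_pwqo Q p : pwqo Q -> pwqo (composed_piece Q p).
Proof.
have [d] := ubnP (k.+1 - p); elim: d p Q => // d IH p Q; rewrite ltnS => kp wQ.
case: (leqP p k) => pk.
  by apply: composed_step => // Q'; apply: IH; rewrite subSS; move: kp; rewrite subSn.
apply: wqo_mono (pwqo_union wQ (node_pwqo wQ)) => x [cx vx ix]; split=> //.
move: cx vx; rewrite /composed_piece /node_of /=; case: (up x) => G [v|l r] /=; first by case; auto.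
case=> [|[[_ ql] [_ qr]] vx]; first by left.
have [[_ _ _ vl] [_ _ _ vr]] := valid_children vx.
right; split; [case: ql|case: qr] => // pc.
  by have := leq_trans (leq_trans pk pc) (vl _ (lset_in_nodes _)); rewrite ltnn.
by have := leq_trans (leq_trans pk pc) (vr _ (lset_in_nodes _)); rewrite ltnn.
Qed.

Definition is_leaf (u : piece) : Prop := if projT2 u is Leaf _ then True else False.

Lemma nat_good (n : nat -> nat) : exists i j, i < j /\ n i <= n j.
Proof.
have [i Hi] : exists i, forall j, n i <= n j; last by exists i, i.+1.
have : exists m, exists i, n i = m by exists (n 0), 0.
case=> m; elim/ltn_ind: m => m IH [i Ei].
case: (classic (exists j, n j < m)) => [[j lt]|no]; first by apply: IH lt _; exists j.
by exists i => j; rewrite Ei leqNgt; apply/negP => lt; apply: no; exists j.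
Qed.

Definition leaf_data (x : lpiece) (dn : {set L * bool} * nat) : Prop :=
  exists (G : digraph) (v : vertex G) (a : edge G -> L),
  [/\ x = LPiece (up := Piece (Leaf v)) a,
      dn.1 = [set (a e, tail e == v) | e in rho [set v]]
    & dn.2 = #|[set e : edge G | (tail e == v) && (head e == v)]|].

(** Labels and directions of the boundary edges form one of finitely many sets. Loops are not in
    [rho], so their number is unbounded and is compared as a natural number. *)
Lemma leaf_pwqo : pwqo is_leaf.
Proof.
move=> x Lx.
have [dn Hdn] : exists dn, forall i, leaf_data (x i) (dn i).
  apply: (@choice_fun _ _ (fun i => leaf_data (x i))) => i.
  case: (x i) (Lx i) => -[G [v|l r]] a [] // _ _ _.
  by eexists (_, _); exists G, v, a; split.
have [phi [d [inc Hd]]] := pigeonhole (fun i => (dn i).1).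
have [i [j [ij nij]]] := nat_good (fun i => (dn (phi i)).2).
exists (phi i), (phi j); split; first exact: inc.
move: (Hd i) (Hd j) nij (Lx (phi i)) (Hdn (phi i)) (Hdn (phi j)).
move=> di dj nij [_ _ inj] [G [v [a [Ex Ed En]]]] [G' [v' [a' [Ex' Ed' En']]]].
rewrite {}Ex in inj *; rewrite {}Ex'; rewrite En En' in nij.
apply: emb_leaf => //= e er.
have : (a e, tail e == v) \in d by rewrite -di Ed; apply/imsetP; exists e.
by rewrite -dj Ed' => /imsetP[e' er' [E1 E2]]; exists e'.
Qed.

Lemma valid_pwqo : pwqo (fun _ => True).
Proof.
apply: wqo_mono (composed_pwqo (p := 0) leaf_pwqo) => x [_ vx ix]; split=> // {vx ix}.
rewrite /composed_piece; elim: (projT2 (up x)) => [v|l Hl r Hr] /=; first by left.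
by right; split; split=> //; right.
Qed.
End Main.

(** * From carvings to binary trees *)

Lemma cut_sum (G : digraph) (X : {set vertex G}) :
  cut X = \sum_(e : edge G) ((tail e \in X) != (head e \in X)).
Proof. by rewrite /cut -sum1_card big_mkcond; apply: eq_bigr => e _; rewrite inE; case: (_ != _). Qed.

Lemma cut_submod (G : digraph) (A B : {set vertex G}) :
  cut (A :&: B) + cut (A :|: B) <= cut A + cut B.
Proof.
rewrite !cut_sum -!big_split; apply: leq_sum => e _; rewrite /= !inE.
by do 4!case: (_ \in _).
Qed.

Lemma cut_posimod (G : digraph) (A B : {set vertex G}) :
  cut (A :\: B) + cut (B :\: A) <= cut A + cut B.
Proof.
rewrite !cut_sum -!big_split; apply: leq_sum => e _; rewrite /= !inE.
by do 4!case: (_ \in _).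
Qed.

(** * Components of a tree minus an edge *)

Section Tree.
Variable T : tree.
Implicit Types s t u : node T.

Lemma connect_invariant (e : rel (node T)) (P : node T -> Prop) s t :
  P s -> (forall u v, P u -> e u v -> P v) -> connect e s t -> P t.
Proof.
move=> Ps Pe /connectP[p pp ->]; elim: p s Ps pp => //= u p IH s Ps /andP[su pp].
exact: IH (Pe _ _ Ps su) pp.
Qed.

Lemma adj_neq s t : adj s t -> s != t.
Proof. by apply: contraTneq => ->; rewrite adj_irr. Qed.

Lemma adj_delE t1 t2 u v : adj_del t1 t2 u v =
  [&& adj u v, (u, v) != (t1, t2) & (u, v) != (t2, t1)].
Proof. by rewrite /adj_del /= -andbA. Qed.

Lemma adj_delC t1 t2 : adj_del t1 t2 =2 adj_del t2 t1.
Proof. by move=> u v; rewrite !adj_delE [(_ != _) && _]andbC. Qed.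

Lemma adj_del_sym t1 t2 : symmetric (adj_del t1 t2).
Proof.
move=> u v; rewrite !adj_delE adj_sym; congr (_ && _).
by rewrite !xpair_eqE andbC [(u == t2) && _]andbC [(u == t1) && _]andbC.
Qed.

Lemma side_refl t1 t2 : t1 \in side t1 t2.
Proof. by rewrite inE connect0. Qed.

Lemma bridge t1 t2 : adj t1 t2 -> t2 \notin side t1 t2.
Proof.
move=> a12; rewrite inE; apply/negP => /connectP[p0 /shortenP[p pp up _] E].
have := @tree_acyclic T (t1 :: p); suff [-> ->] : (2 < size (t1 :: p)) /\ ucycleb (@adj T) (t1 :: p) by move/(_ isT).
split.
  case: p pp E {up} => [|a [|b p]] //=; first by move=> _ E; rewrite -E adj_irr in a12.
  by rewrite adj_delE andbT => /and3P[_ + _] E; rewrite -E eqxx.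
rewrite /ucycleb /= rcons_path -E adj_sym a12 andbT; apply/andP; split => //.
by apply: sub_path pp => u v; rewrite adj_delE => /and3P[].
Qed.

Lemma adj_del_avoid t1 t2 u v : adj u v -> u != t1 -> v != t1 -> adj_del t1 t2 u v.
Proof. by move=> uv u1 v1; rewrite adj_delE uv !xpair_eqE (negbTE u1) (negbTE v1) andbF. Qed.

Lemma side_step t1 a u v : adj a t1 -> u \in side a t1 -> adj_del a t1 u v ->
  [/\ v \in side a t1, adj u v, u != t1 & v != t1].
Proof.
move=> aa us uv; have vs : v \in side a t1.
  by move: us; rewrite !inE => us; apply: connect_trans us (connect1 uv).
split=> //; first by move: uv; rewrite adj_delE => /and3P[].
  by apply: contraTneq us => ->; apply: bridge.
by apply: contraTneq vs => ->; apply: bridge.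
Qed.

Lemma side_sub t1 t2 a : adj t1 t2 -> adj t1 a -> a != t2 -> side a t1 \subset side t1 t2.
Proof.
move=> a12 a1a nat2; have aa : adj a t1 by rewrite adj_sym.
apply/subsetP => s; rewrite inE => cs.
apply: (proj2 (connect_invariant (P := fun u => u \in side a t1 /\ u \in side t1 t2) _ _ cs)) => [|u v [ua ut] uv].
  split; first exact: side_refl.
  rewrite inE; apply: connect1; rewrite adj_delE a1a !xpair_eqE eqxx (negbTE nat2) /=.
  by rewrite (negbTE (adj_neq a12)).
have [va auv u1 v1] := side_step aa ua uv; split=> //.
move: ut; rewrite !inE => ut; apply: connect_trans ut (connect1 _).
exact: adj_del_avoid.
Qed.

Lemma side_disjoint t1 a b : adj t1 a -> adj t1 b -> a != b -> [disjoint side a t1 & side b t1].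
Proof.
move=> a1 b1 nab; have aa : adj a t1 by rewrite adj_sym.
have bb : adj b t1 by rewrite adj_sym.
rewrite -setI_eq0; apply/eqP/setP => s; rewrite in_setI in_set0; apply/negP => /andP[sa].
rewrite inE => cs.
have [_ bs] : s \in side b t1 /\ connect (adj_del a t1) b s.
  apply: (connect_invariant (P := fun u => u \in side b t1 /\ connect (adj_del a t1) b u) _ _ cs) => [|u v [ub cu] uv].
    by split; rewrite ?side_refl.
  have [vb auv u1 v1] := side_step bb ub uv; split=> //.
  by apply: connect_trans cu (connect1 _); rewrite adj_delC; apply: adj_del_avoid.
have /negP[] := bridge aa; rewrite inE in sa; rewrite inE; apply: connect_trans sa _.
rewrite (sym_connect_sym (adj_del_sym a t1)).
apply: (connect_trans (connect1 _) bs); rewrite adj_delE b1 !xpair_eqE.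
by rewrite (negbTE (adj_neq a1)) [b == a]eq_sym (negbTE nab) !andbF.
Qed.

Lemma path_side t1 a p : adj t1 a -> path (@adj T) a p -> t1 \notin a :: p ->
  last a p \in side a t1.
Proof.
move=> a1 pp np; rewrite inE; apply/connectP; exists p => //.
apply: (sub_in_path (P := fun u => u != t1) (e := @adj T)) => //.
  by move=> u v /= u1 v1 uv; rewrite adj_delC adj_del_avoid.
by apply/allP => u up /=; apply: contraNneq np => <-.
Qed.

Lemma side_cases t1 t2 s : adj t1 t2 -> s \in side t1 t2 -> s != t1 ->
  exists a, [/\ adj t1 a, a != t2 & s \in side a t1].
Proof.
move=> a12; rewrite inE => /connectP[p0 /shortenP[p pp up _] ->].
case: p pp up => [|a p] /=; first by rewrite eqxx.
rewrite adj_delE => /andP[/and3P[a1 ne _] pp] /andP[n1 _] _; exists a; split=> //.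
  by apply: contraNneq ne => ->.
by apply: path_side => //; apply: sub_path pp => u v; rewrite adj_delE => /and3P[].
Qed.

Lemma side_total t1 t2 s : adj t1 t2 -> s \in side t1 t2 \/ s \in side t2 t1.
Proof.
move=> a12; have /connectP[p0 /shortenP[p pp up _] ->] := tree_connected t1 s.
case: p pp up => [|a p] /=; first by left; exact: side_refl.
case/andP=> a1 pp /andP[n1 _]; have sa := path_side a1 pp n1.
have [<-|na] := eqVneq a t2; first by right.
by left; apply: (subsetP (side_sub a12 a1 na)).
Qed.

Lemma side_compl t1 t2 : adj t1 t2 -> [disjoint side t1 t2 & side t2 t1].
Proof.
move=> a12; rewrite -setI_eq0; apply/eqP/setP => s; rewrite !inE; apply/negP => /andP[c1 c2].
have /negP[] := bridge a12; rewrite inE; apply: connect_trans c1 _.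
rewrite (eq_connect (adj_delC t2 t1)) in c2.
by rewrite (sym_connect_sym (adj_del_sym t1 t2)).
Qed.
End Tree.

Section CarvingTree.
Variables (G : digraph) (C : carving G) (k : nat).
Hypothesis Ck : width C <= k.
Let T := carving_tree C.
Let m := @carving_map G C.

Definition side_verts (t1 t2 : node T) : {set vertex G} := [set v | m v \in side t1 t2].

Lemma cut_side t1 t2 : adj t1 t2 -> cut (side_verts t1 t2) <= k.
Proof.
move=> a12; apply: leq_trans Ck.
exact: (@leq_bigmax_cond _ (fun p : node T * node T => adj p.1 p.2)
   (fun p => @edge_width G C p.1 p.2) (t1, t2) a12).
Qed.

(* [W] may be empty: leaves of a carving need not carry a vertex. *)
Definition realized (W : {set vertex G}) := W = set0 \/
  exists t, [/\ wf t, lset t = W & {in nodes t, forall A, cut A <= k}].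

Lemma realized_union (W1 W2 : {set vertex G}) : [disjoint W1 & W2] -> cut (W1 :|: W2) <= k ->
  realized W1 -> realized W2 -> realized (W1 :|: W2).
Proof.
move=> D ck [->|[t1 [w1 E1 c1]]]; first by rewrite set0U.
case=> [->|[t2 [w2 E2 c2]]]; first by rewrite setU0; right; exists t1.
right; exists (Node t1 t2); split; rewrite /= ?E1 ?E2 ?w1 ?w2 //.
by move=> A; rewrite inE mem_cat => /or3P[/eqP->|/c1|/c2].
Qed.

(** At a leaf [t1] the side is [t1] alone and carries at most one vertex. Otherwise the two
    neighbours of [t1] other than [t2] have smaller sides, which become the children. *)
Lemma side_realized t1 t2 : adj t1 t2 -> realized (side_verts t1 t2).
Proof.
have [n] := ubnP #|side t1 t2|; elim: n t1 t2 => // n IH t1 t2; rewrite ltnS => sn a12.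
have nbr2 : t2 \in [set s | adj t1 s] by rewrite inE.
have [lf|nlf] := boolP (leaf t1).
  have s1 : side t1 t2 = [set t1].
    apply/setP => s; rewrite [RHS]inE; apply/idP/eqP => [st|->]; last exact: side_refl.
    apply/eqP; apply: contraT => /(side_cases a12 st)[a [a1 na _]].
    case/cards1P: lf => u Eu; move: nbr2; rewrite Eu inE => /eqP E2.
    have : a \in [set s | adj t1 s] by rewrite inE.
    by rewrite Eu inE -E2 (negbTE na).
  case: (set_0Vmem (side_verts t1 t2)) => [->|[v vW]]; first by left.
  have Ev : [set v] = side_verts t1 t2.
    move: vW; rewrite in_set s1 in_set1 => /eqP mv.
    apply/setP => u; rewrite in_set1 in_set s1 in_set1.
    by apply/eqP/eqP => [->//|mu]; apply: (@carving_inj _ C); rewrite -/m mu mv.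
  right; exists (Leaf v); split=> // A; rewrite /= inE => /eqP->.
  by rewrite Ev cut_side.
have := carving_cubic nlf; rewrite /degree (cardsD1 t2) nbr2 => -[/eqP/cards2P[a [b [nab Eab]]]].
have [a1 na] : adj t1 a /\ a != t2.
  have : a \in [set s | adj t1 s] :\ t2 by rewrite Eab !inE eqxx.
  by rewrite !inE => /andP[].
have [b1 nb] : adj t1 b /\ b != t2.
  have : b \in [set s | adj t1 s] :\ t2 by rewrite Eab !inE eqxx orbT.
  by rewrite !inE => /andP[].
have D := side_disjoint a1 b1 nab.
have EW : side_verts t1 t2 = side_verts a t1 :|: side_verts b t1.
  apply/setP => v; rewrite in_setU ![v \in side_verts _ _]in_set; apply/idP/orP => [vs|].
    have nv1 : m v != t1 by apply: contraNneq nlf => <-; exact: carving_leaf.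
    have [c [c1 nc sc]] := side_cases a12 vs nv1.
    have : c \in [set s | adj t1 s] :\ t2 by rewrite !inE c1 nc.
    by rewrite Eab in_set2 => /orP[] /eqP Ec; rewrite -Ec; [left|right].
  by case; apply: (subsetP (side_sub a12 _ _)).
have lt c : adj t1 c -> c != t2 -> #|side c t1| < n.
  move=> c1 nc; apply: leq_trans sn; apply: proper_card; apply/properP.
  split; first exact: side_sub.
  by exists t1; [exact: side_refl|apply: bridge; rewrite adj_sym].
rewrite EW; apply: realized_union.
- rewrite -setI_eq0; apply/eqP/setP => v; rewrite in_setI ![v \in side_verts _ _]in_set in_set0.
  by apply/negP => /andP[h1]; rewrite (disjointFr D h1).
- by rewrite -EW cut_side.
- by apply: IH; [exact: lt|rewrite adj_sym].
- by apply: IH; [exact: lt|rewrite adj_sym].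
Qed.

Lemma carving_btree : 0 < #|vertex G| ->
  exists t : btree (vertex G), [/\ wf t, lset t = setT & {in nodes t, forall A, cut A <= k}].
Proof.
move=> nG; have [t0 _] : exists t : node T, t \in predT.
  by have /card_gt0P[t] := tree_nonempty T; exists t.
(* A single node has degree zero, hence would be a non-leaf of degree other than three. *)
have [t1 a01] : exists t1, adj t0 t1.
  have : 0 < degree t0.
    by have [/eqP->|/carving_cubic->] := boolP (leaf t0).
  by case/card_gt0P => t1; rewrite inE; exists t1.
have a10 : adj t1 t0 by rewrite adj_sym.
have ET : side_verts t0 t1 :|: side_verts t1 t0 = setT.
  by apply/setP => v; rewrite !in_setU in_setT ![v \in side_verts _ _]in_set;
    apply/orP; exact: side_total.
have [] := realized_union _ _ (side_realized a01) (side_realized a10).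
- rewrite -setI_eq0; apply/eqP/setP => v.
  rewrite in_setI ![v \in side_verts _ _]in_set in_set0.
  by apply/negP => /andP[h1]; rewrite (disjointFr (side_compl a01) h1).
- rewrite ET /cut (_ : rho setT = set0) ?cards0 //.
  by apply/setP => e; rewrite !inE.
- by rewrite ET => /setP E; case/card_gt0P: nG => v _; have := E v; rewrite !inE.
by rewrite ET.
Qed.
End CarvingTree.

Theorem theorem1p4 (k : nat) (G : nat -> digraph)
    (hEuler : forall i : nat, Eulerian (G i))
    (hcw : forall i : nat, carving_width_at_most (G i) k) :
  exists i j : nat, i < j /\ strongly_immerses (G i) (G j).
Proof.
(* A [btree] has at least one leaf, so a digraph without vertices is treated apart; it immerses into
   every digraph. *)
have [[i /eqP Gi0]|nG] := classic (exists i, #|vertex (G i)| == 0).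
  exists i, i.+1; split=> //.
  have nov (v : vertex (G i)) : False by have := fintype0 v Gi0.
  exists (fun v => False_rect _ (nov v)), (fun e => False_rect _ (nov (tail e))).
  by split=> [v|e|e|e]; [case: (nov v)|case: (nov (tail e))..].
have [x Hx] : exists x : nat -> lpiece k, forall i, exists (t : btree (vertex (G i)))
    (a : edge (G i) -> 'I_k.+1), [/\ x i = LPiece (up := Piece t) a, lset t = setT &
      labelled (fun _ => True) (x i)].
  apply: (@choice_fun _ _ (fun i y => exists (t : btree (vertex (G i)))
    (a : edge (G i) -> 'I_k.+1), [/\ y = LPiece (up := Piece t) a, lset t = setT &
      labelled (fun _ => True) y])) => i.
  have [w [[C CE] _] wk] := hcw i; rewrite -CE in wk.
  have n0 : 0 < #|vertex (G i)| by rewrite lt0n; apply/negP => E; apply: nG; exists i.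
  have [t0 [w0 E0 c0]] := carving_btree wk n0.
  have [t [wt Et lt ct]] := linked_tree_exists (@cut_submod _) (@cut_posimod _) w0 c0.
  have vt : valid k (Piece t) by split=> //; exact: hEuler.
  have [a ia] := labels_exist vt.
  by exists (LPiece (up := Piece t) a), t, a; split; [|exact: etrans Et E0|split].
have [|i [j [ij lij]]] := @valid_pwqo k x; first by move=> i; have [t [a []]] := Hx i.
exists i, j; split=> //; move: lij.
have [t [a [-> Et _]]] := Hx i; have [t' [a' [-> _ _]]] := Hx j.
exact: emb_total.
Qed.
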